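(* Let $(\mathcal{A},d)$ be a graded commutative DGA over $\mathbb{Q}$, and let $\mathcal{Z}^* := \ker d$. Choose a (degree-preserving linear) right inverse $\alpha \colon H^*(\mathcal{A}) \to \mathcal{Z}^*$ for the projection to cohomology, and a linear map $\gamma \colon E^* \to \mathcal{A}^{*-1}$ such that $d\gamma = \alpha^2$ on $E^*$. Then the linear map $$\gamma\cdot\alpha^2 \colon \mathcal{G}^2E^* \to \mathcal{A}^{*-1}, \qquad ee' \mapsto \tfrac12\big(\gamma(e)\alpha^2(e') + (-1)^{pq}\gamma(e')\alpha^2(e)\big) \quad (e\in E^p,\ e'\in E^q)$$ takes values in $\mathcal{Z}^{*-1}$ on $\mathcal{B}^*(\mathcal{A}) := \mathcal{B}^*(H^*(\mathcal{A}))$, and the induced map $$\mathcal{F} \colon \mathcal{B}^*(\mathcal{A}) \to H^{*-1}(\mathcal{A})$$ is independent of the choice of $\gamma$ and $\alpha$.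
   Context: For a graded vector space $V$, $\mathcal{G}^k V$ is the quotient of $V^{\otimes k}$ by the relations of graded symmetry (transposing adjacent homogeneous factors $x,y$ introduces $(-1)^{|x||y|}$), graded by total degree. For a graded commutative algebra $H^*$, $E^* \subseteq \mathcal{G}^2 H^*$ is the kernel of the map $\mathcal{G}^2 H^* \to H^*$ induced by the product; $K[\mathcal{G}^2\mathcal{G}^2 H^*]$ is the kernel of the natural full symmetrisation map $\mathcal{G}^2\mathcal{G}^2 H^* \to \mathcal{G}^4 H^*$; and $\mathcal{B}^*(H^* ) := \mathcal{G}^2 E^* \cap K[\mathcal{G}^2\mathcal{G}^2 H^*]$. Here $E^*$ is taken for $H^*=H^*(\mathcal{A})$, and $\alpha^2\colon\mathcal{G}^2H^*(\mathcal{A})\to\mathcal{Z}^*$ denotes the map induced by $xy\mapsto\alpha(x)\alpha(y)$. *)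

(* Defs.v *)
From HB Require Import structures.
From mathcomp Require Import all_boot all_order all_algebra.
From mathcomp Require Import boolp freeg ring.

Set Implicit Arguments.
Unset Strict Implicit.
Unset Printing Implicit Defensive.

Import GRing.Theory.
Local Open Scope ring_scope.
Local Open Scope quotient_scope.

(* -------------------------------------------------------------------- *)
Section Subspaces.
Variable V : lmodType rat.

Definition lspan (P : V -> Prop) : {pred V} :=
  [pred x | `[< forall S : submodClosed V,
                  (forall y, P y -> y \in S) -> x \in S >]].

Fact lspan_submod P : submod_closed (lspan P).
Proof.
split=> [|a x y /asboolP xP /asboolP yP].
  by apply/asboolP=> S _; rewrite rpred0.
by apply/asboolP=> S PS; rewrite rpredD ?rpredZ ?xP ?yP.
Qed.

HB.instance Definition _ P :=
  GRing.isSubmodClosed.Build rat V (lspan P) (lspan_submod P).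

Lemma mem_lspan (P : V -> Prop) x : P x -> x \in lspan P.
Proof. by move=> Px; apply/asboolP=> S; apply. Qed.

Variable S : submodClosed V.

Definition subspace := {x : V | x \in S}.
HB.instance Definition _ := [isSub of subspace for @sval V (fun x => x \in S)].
HB.instance Definition _ := [Choice of subspace by <:].
HB.instance Definition _ := [SubChoice_isSubLmodule of subspace by <:].

Definition quot_pred : {pred V} := S.

Fact quot_pred_submod : submod_closed quot_pred.
Proof. by split=> [|a x y xS yS]; rewrite ?rpred0 // rpredD ?rpredZ. Qed.

HB.instance Definition _ :=
  GRing.isSubmodClosed.Build rat V quot_pred quot_pred_submod.

Definition quotSpace := Quotient.quot quot_pred.
HB.instance Definition _ := GRing.Zmodule.on quotSpace.

Definition qclass (x : V) : quotSpace := \pi_(Quotient.quot quot_pred) x.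

Lemma qclass_eq x y : (qclass x == qclass y) = (x - y \in S).
Proof. by rewrite /qclass -Quotient.idealrBE. Qed.

Lemma qclassP x y : qclass x = qclass y <-> x - y \in S.
Proof. by rewrite -qclass_eq; split=> [->|/eqP]. Qed.

Lemma qclass_reprK (u : quotSpace) : qclass (repr (u : Quotient.quot quot_pred)) = u.
Proof. exact: reprK. Qed.

Lemma qclassB x y : qclass (x - y) = qclass x - qclass y.
Proof. exact: raddfB. Qed.

Lemma qclass_surj (u : quotSpace) : exists x, u = qclass x.
Proof. by exists (repr (u : Quotient.quot quot_pred)); rewrite qclass_reprK. Qed.

Definition qscale (a : rat) (u : quotSpace) : quotSpace :=
  qclass (a *: repr (u : Quotient.quot quot_pred)).

Lemma qscaleE a x : qscale a (qclass x) = qclass (a *: x).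
Proof.
apply/qclassP; rewrite -scalerBr rpredZ //; apply/qclassP.
exact: qclass_reprK.
Qed.

Lemma qclassD x y : qclass (x + y) = qclass x + qclass y.
Proof. exact: raddfD. Qed.

Fact qscaleA a b u : qscale a (qscale b u) = qscale (a * b) u.
Proof. by case: (qclass_surj u) => x ->; rewrite !qscaleE scalerA. Qed.
Fact qscale1 : left_id 1 qscale.
Proof. by move=> u; case: (qclass_surj u) => x ->; rewrite !qscaleE scale1r. Qed.
Fact qscaleDr : right_distributive qscale +%R.
Proof.
move=> a u v; case: (qclass_surj u) (qclass_surj v) => x -> [y ->].
by rewrite -qclassD !qscaleE scalerDr qclassD.
Qed.
Fact qscaleDl u : {morph qscale^~ u : a b / a + b}.
Proof.
by move=> a b; case: (qclass_surj u) => x ->; rewrite !qscaleE scalerDl qclassD.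
Qed.

HB.instance Definition _ := GRing.Zmodule_isLmodule.Build rat quotSpace
  qscaleA qscale1 qscaleDr qscaleDl.

Fact qclass_linear : linear qclass.
Proof. by move=> a x y; rewrite qclassD -qscaleE. Qed.

HB.instance Definition _ := GRing.isLinear.Build rat V quotSpace _ qclass qclass_linear.

End Subspaces.

Arguments qclass {V S}.

Lemma quot_eq0 (V : lmodType rat) (S : submodClosed V) (x : V) :
  (qclass x == 0 :> quotSpace S) = (x \in S).
Proof. by rewrite -(raddf0 (@qclass V S)) qclass_eq subr0. Qed.

Section Kernel.
Variables (V W : lmodType rat) (f : {linear V -> W}).

Definition kernel : {pred V} := [pred x | f x == 0].

Fact kernel_submod : submod_closed kernel.
Proof.
split=> [|a x y]; rewrite !inE ?linear0 // => /eqP fx /eqP fy.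
by rewrite linearP fx fy scaler0 addr0.
Qed.

HB.instance Definition _ :=
  GRing.isSubmodClosed.Build rat V kernel kernel_submod.

Lemma lspan_kernel (P : V -> Prop) x :
  (forall y, P y -> f y = 0) -> x \in lspan P -> f x = 0.
Proof.
move=> fP /asboolP/(_ kernel) xP; apply/eqP/xP => y /fP fy.
by rewrite inE fy.
Qed.

End Kernel.

Section QuotientLift.
Variables (V W : lmodType rat) (S : submodClosed V).

Definition qlift (f : V -> W) (u : quotSpace S) : W :=
  f (repr (u : Quotient.quot (quot_pred S))).

Variable f : {linear V -> W}.
Hypothesis fS : forall x, x \in S -> f x = 0.

Lemma qliftE x : qlift f (qclass x) = f x.
Proof.
apply/eqP; rewrite -subr_eq0 -linearB; apply/eqP/fS.
by apply/qclassP; rewrite qclass_reprK.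
Qed.

Lemma qlift_linear : linear (qlift f).
Proof.
move=> a u v; case: (qclass_surj u) (qclass_surj v) => x -> [y ->].
by rewrite -linearP !qliftE linearP.
Qed.
End QuotientLift.

(* -------------------------------------------------------------------- *)
(* Z-graded rational vector spaces, as internal direct sums; [homog n x]
   reads "x lies in degree n", so that 0 lies in every degree. *)
Record gradedSpace := GradedSpace {
  gr_sort :> lmodType rat;
  homog : int -> gr_sort -> Prop;
  homog0 : forall n, homog n 0;
  homogP : forall n a x y, homog n x -> homog n y -> homog n (a *: x + y);
  homog_gen : forall x, exists (s : seq int) (c : int -> gr_sort),
    [/\ uniq s, forall n, homog n (c n) & x = \sum_(n <- s) c n];
  homog_free : forall (s : seq int) (c : int -> gr_sort),
    uniq s -> (forall n, homog n (c n)) -> \sum_(n <- s) c n = 0 ->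
    forall n, n \in s -> c n = 0
}.

Section GradingBuild.
Variables (V : lmodType rat) (h : int -> V -> Prop).
Hypothesis h0 : forall n, h n 0.
Hypothesis hP : forall n a x y, h n x -> h n y -> h n (a *: x + y).

Definition weighted (w : int -> rat) (x y : V) : Prop :=
  exists (s : seq int) (c : int -> V),
    [/\ uniq s, forall n, h n (c n), x = \sum_(n <- s) c n
      & y = \sum_(n <- s) w n *: c n].

Lemma weighted0 w : weighted w 0 0.
Proof. by exists [::], (fun=> 0); split=> //; rewrite big_nil. Qed.

Lemma weighted_homog w n x : h n x -> weighted w x (w n *: x).
Proof.
move=> hx; exists [:: n], (fun m => if m == n then x else 0).
split=> // [m||]; rewrite ?big_seq1 ?eqxx //.
by case: eqP => [->|].
Qed.

Lemma big_undup_cat (s s' : seq int) (F : int -> V) : uniq s ->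
  \sum_(n <- undup (s ++ s')) (if n \in s then F n else 0) = \sum_(n <- s) F n.
Proof.
move=> us; rewrite -big_mkcond /= -big_filter; apply: perm_big.
apply: uniq_perm; rewrite ?filter_uniq ?undup_uniq // => n.
by rewrite mem_filter mem_undup mem_cat; case: (n \in s).
Qed.

Lemma big_undup_catr (s s' : seq int) (F : int -> V) : uniq s' ->
  \sum_(n <- undup (s ++ s')) (if n \in s' then F n else 0) =
  \sum_(n <- s') F n.
Proof.
move=> us; rewrite -big_mkcond /= -big_filter; apply: perm_big.
apply: uniq_perm; rewrite ?filter_uniq ?undup_uniq // => n.
by rewrite mem_filter mem_undup mem_cat; case: (n \in s'); rewrite ?orbT.
Qed.

Lemma weightedP w a x y x' y' :
  weighted w x y -> weighted w x' y' -> weighted w (a *: x + x') (a *: y + y').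
Proof.
move=> [s [c [us hc -> ->]]] [s' [c' [us' hc' -> ->]]].
exists (undup (s ++ s')), (fun n => a *: (if n \in s then c n else 0) +
                                    (if n \in s' then c' n else 0)).
split; first exact: undup_uniq.
- by move=> n; apply: hP; case: ifP.
- by rewrite big_split -scaler_sumr /= big_undup_cat ?big_undup_catr.
rewrite -(big_undup_cat s' (fun n => w n *: c n)) //.
rewrite -(big_undup_catr s (fun n => w n *: c' n)) //.
rewrite scaler_sumr -big_split /=; apply: eq_bigr => n _.
rewrite scalerDr !scalerA mulrC -scalerA.
by do 2![case: ifP => _]; rewrite ?scaler0.
Qed.

Lemma grading_gen :
  (forall x, x \in lspan (fun y => exists n, h n y)) ->
  forall x, exists (s : seq int) (c : int -> V),
    [/\ uniq s, forall n, h n (c n) & x = \sum_(n <- s) c n].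
Proof.
pose D := [pred x | `[< exists y, weighted (fun=> 1) x y >]].
have Dsub : submod_closed D.
  split=> [|a x x' /asboolP[y xy] /asboolP[y' xy']]; apply/asboolP.
    by exists 0; apply: weighted0.
  by exists (a *: y + y'); apply: weightedP.
pose DS : submodClosed V := HB.pack (D : {pred V}) (GRing.isSubmodClosed.Build rat V D Dsub).
move=> hspan x; have /asboolP/(_ DS) xD := hspan x.
have /asboolP[_ [s [c [? ? ? _]]]] : x \in DS; last by exists s, c.
apply: xD => y [n hy]; apply/asboolP.
by exists (1 *: y); apply: (@weighted_homog (fun=> 1) n).
Qed.

(* A linear map acting as multiplication by 2 ^ n in each degree n separates
   the degrees. *)
Lemma grading_free (l : {linear V -> V}) :
  (forall n x, h n x -> l x = (2%:R : rat) ^ n *: x) ->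
  forall (s : seq int) (c : int -> V), uniq s -> (forall n, h n (c n)) ->
  \sum_(n <- s) c n = 0 -> forall n, n \in s -> c n = 0.
Proof.
move=> lE; have inj (m n : int) : (2%:R : rat) ^ m = 2%:R ^ n -> m = n.
  exact: ieexprIz.
elim=> // m s IHs c /= /andP[ms us] hc.
rewrite big_cons => /eqP; rewrite addr_eq0 => /eqP cmE.
pose c' n : V := ((2%:R : rat) ^ n - 2%:R ^ m) *: c n.
have c'0 n : n \in s -> c' n = 0.
  apply: (IHs c') => // [k|]; first by rewrite -[c' k]addr0; apply: hP.
  under eq_bigr do rewrite /c' scalerBl -lE //.
  rewrite sumrB -linear_sum -scaler_sumr -[\sum_(i <- s) c i]opprK -cmE.
  by rewrite linearN (lE m) // scalerN opprK addrC subrr.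
have c0 n : n \in s -> c n = 0.
  move=> ns; have /eqP := c'0 n ns; rewrite scaler_eq0 => /orP[|/eqP//].
  by rewrite subr_eq0 => /eqP/inj nm; rewrite nm (negPf ms) in ns.
have cm0 : c m = 0 by rewrite cmE big_seq big1 ?oppr0.
by move=> n; rewrite inE => /orP[/eqP->|/c0].
Qed.

End GradingBuild.

Section GradedTheory.
Variable V : gradedSpace.
Implicit Types (x y : V) (n : int).

Lemma homogD n x y : homog n x -> homog n y -> homog n (x + y).
Proof. by move=> hx hy; rewrite -[x]scale1r; apply: homogP. Qed.

Lemma homogZ n a x : homog n x -> homog n (a *: x).
Proof. by move=> hx; rewrite -[_ *: _]addr0; apply: homogP => //; apply: homog0. Qed.

Lemma homog_sum n (I : Type) (r : seq I) (F : I -> V) :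
  (forall i, homog n (F i)) -> homog n (\sum_(i <- r) F i).
Proof.
by move=> hF; apply: big_ind => [||i _]; [apply: homog0|apply: homogD|].
Qed.

Lemma weighted_fun w x : exists y, weighted (@homog V) w x y.
Proof.
have [s [c [us hc ->]]] := homog_gen x.
by exists (\sum_(n <- s) w n *: c n), s, c.
Qed.

Lemma weighted_uniq w x y y' :
  weighted (@homog V) w x y -> weighted (@homog V) w x y' -> y = y'.
Proof.
move=> xy /(weightedP (@homog0 V) (@homogP V) (-1))/(_ xy).
rewrite !scaleN1r addNr => -[s [c [us hc /esym x0 /eqP]]].
rewrite addrC big_seq big1 ?subr_eq0 => [/eqP//|n ns].
by rewrite (homog_free us hc x0 ns) scaler0.
Qed.

Definition grscale (w : int -> rat) (x : V) : V := sval (cid (weighted_fun w x)).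

Lemma grscaleP w x : weighted (@homog V) w x (grscale w x).
Proof. exact: svalP (cid (weighted_fun w x)). Qed.

Fact grscale_linear w : linear (grscale w).
Proof.
move=> a x y; apply: (weighted_uniq (grscaleP w _)).
by apply: weightedP (grscaleP w x) (grscaleP w y);
  [apply: homog0|apply: homogP].
Qed.
HB.instance Definition _ w :=
  GRing.isLinear.Build rat V V _ (grscale w) (grscale_linear w).

Lemma grscaleE w n x : homog n x -> grscale w x = w n *: x.
Proof.
move=> hx; apply: (weighted_uniq (grscaleP w _)).
by apply: weighted_homog => //; apply: homog0.
Qed.

Lemma homog_spanP (W : lmodType rat) (f g : {linear V -> W}) :
  (forall n x, homog n x -> f x = g x) -> f =1 g.
Proof.
move=> fg x; have [s [c [us hc ->]]] := homog_gen x.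
by rewrite !linear_sum; apply: eq_bigr => n _; apply: fg.
Qed.

End GradedTheory.

Definition has_degree (V W : gradedSpace) (k : int) (f : V -> W) : Prop :=
  forall n x, homog n x -> homog (n + k) (f x).

Section GradedKernel.
Variables (V W : gradedSpace) (k : int) (f : {linear V -> W}).
Hypothesis fk : has_degree k f.

Let K := subspace (kernel f).
Let h n (x : K) := homog n (val x).

Fact grkernel0 n : h n 0.
Proof. exact: homog0. Qed.

Fact grkernelP n a (x y : K) : h n x -> h n y -> h n (a *: x + y).
Proof. exact: homogP. Qed.

Fact grkernel_gen x : exists (s : seq int) (c : int -> K),
    [/\ uniq s, forall n, h n (c n) & x = \sum_(n <- s) c n].
Proof.
have [s [c [us hc xE]]] := homog_gen (val x).
pose s' := [seq n + k | n <- s].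
have us' : uniq s' by rewrite map_inj_uniq //; apply: addIr.
have fc n : n \in s -> f (c n) = 0.
  move=> ns; have hfc m : homog m (f (c (m - k))).
    by rewrite -{1}(subrK k m); apply: fk.
  rewrite -[n](addrK k); apply: (homog_free us' hfc); last exact: map_f.
  rewrite big_map; under eq_bigr do rewrite addrK.
  by rewrite -linear_sum -xE; apply/eqP; have := valP x.
pose d n := (if n \in s then c n else 0).
have dK n : d n \in kernel f.
  by rewrite /d; case: ifP => ns; rewrite inE ?linear0 ?fc.
exists s, (fun n => Sub (d n) (dK n) : K); split=> // [n|].
  by rewrite /h SubK /d; case: ifP => // _; apply: homog0.
apply: val_inj; rewrite raddf_sum /= xE.
by rewrite big_seq [RHS]big_seq; apply: eq_bigr => n ns; rewrite /d ns.
Qed.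

Fact grkernel_free (s : seq int) (c : int -> K) :
    uniq s -> (forall n, h n (c n)) -> \sum_(n <- s) c n = 0 ->
    forall n, n \in s -> c n = 0.
Proof.
move=> us hc /(congr1 val); rewrite raddf_sum raddf0 => c0 n ns.
by apply: val_inj; apply: (homog_free us hc c0 ns).
Qed.

Definition grkernel : gradedSpace :=
  GradedSpace grkernel0 grkernelP grkernel_gen grkernel_free.

End GradedKernel.

(* -------------------------------------------------------------------- *)
Section FreeModule.
Variables (K : choiceType) (W : lmodType rat).

Fact fglift_linear (f : K -> W) : linear (fglift f : {freeg K / rat} -> W).
Proof.
have fB := lift_is_additive f.
pose F := HB.pack_for {additive {freeg K / rat} -> W} (fglift f)
  (GRing.isZmodMorphism.Build {freeg K / rat} W (fglift f) fB).
move=> a x y; rewrite -[LHS]/(F _) raddfD; congr (_ + _).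
rewrite -{2}[x]freeg_sumE [fglift f _](raddf_sum F) [_ *: x]/(fgscale a x).
rewrite raddf_sum scaler_sumr; apply: eq_bigr => z _.
by rewrite /= !liftU scalerA.
Qed.

HB.instance Definition _ f := GRing.isLinear.Build rat {freeg K / rat} W _
  (fglift f : {freeg K / rat} -> W) (fglift_linear f).

Lemma freeg_ext (f g : {linear {freeg K / rat} -> W}) :
  (forall x, f << x >> = g << x >>) -> f =1 g.
Proof.
move=> fg D; rewrite -[D]freeg_sumE !linear_sum; apply: eq_bigr => z _.
have -> : << coeff z D *g z >> = coeff z D *: << z >> :> {freeg K / rat}.
  by apply/eqP/freeg_eqP => t; rewrite coeffZ !coeffU mul1r.
by rewrite !linearZ /= fg.
Qed.
End FreeModule.

Section TensorPower.
Variables (k : nat) (V : lmodType rat).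

Definition tensor_rel (r : {freeg (k.-tuple V) / rat}) : Prop :=
  exists (s1 s2 : seq V) (a : rat) (x y : V) (t tx ty : k.-tuple V),
    [/\ t = s1 ++ (a *: x + y) :: s2 :> seq V, tx = s1 ++ x :: s2 :> seq V,
        ty = s1 ++ y :: s2 :> seq V
      & r = << t >> - (a *: << tx >> + << ty >>)].

Definition tensorPower := quotSpace (lspan tensor_rel).
HB.instance Definition _ := GRing.Lmodule.on tensorPower.

Definition tensor (t : k.-tuple V) : tensorPower := qclass << t >>.

Definition multilinear (W : lmodType rat) (f : k.-tuple V -> W) : Prop :=
  forall (s1 s2 : seq V) (a : rat) (x y : V) (t tx ty : k.-tuple V),
    t = s1 ++ (a *: x + y) :: s2 :> seq V -> tx = s1 ++ x :: s2 :> seq V ->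
    ty = s1 ++ y :: s2 :> seq V -> f t = a *: f tx + f ty.

Lemma tensor_multilinear : multilinear tensor.
Proof.
move=> s1 s2 a x y t tx ty tE txE tyE; rewrite /tensor -linearP.
by apply/qclassP/mem_lspan; exists s1, s2, a, x, y, t, tx, ty.
Qed.

Definition tensor_lift (W : lmodType rat) (f : k.-tuple V -> W) :
  tensorPower -> W := qlift (fglift f).

Section TensorLift.
Variables (W : lmodType rat) (f : k.-tuple V -> W).
Hypothesis fM : multilinear f.

Fact fglift_tensor_rel r : r \in lspan tensor_rel -> fglift f r = 0.
Proof.
apply: lspan_kernel => _ [s1 [s2 [a [x [y [t [tx [ty [tE txE tyE ->]]]]]]]]].
rewrite linearB linearP /= !liftU !scale1r.
by rewrite (fM tE txE tyE) subrr.
Qed.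

Lemma tensor_liftE t : tensor_lift f (tensor t) = f t.
Proof.
by rewrite /tensor_lift (qliftE fglift_tensor_rel) /= liftU scale1r.
Qed.

Lemma tensor_lift_linear : linear (tensor_lift f).
Proof. exact: (qlift_linear fglift_tensor_rel). Qed.
End TensorLift.

Lemma tensor_ext (W : lmodType rat) (f g : {linear tensorPower -> W}) :
  (forall t, f (tensor t) = g (tensor t)) -> f =1 g.
Proof.
move=> fg u; have [x ->] := qclass_surj u.
exact: (freeg_ext (f := f \o qclass) (g := g \o qclass)).
Qed.

End TensorPower.

Section SymmetricPower.
Variables (k : nat) (V : gradedSpace).

Definition sym_rel (r : tensorPower k V) : Prop :=
  exists (s1 s2 : seq V) (p q : int) (x y : V) (t t' : k.-tuple V),
    [/\ homog p x, homog q y, t = s1 ++ x :: y :: s2 :> seq V,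
        t' = s1 ++ y :: x :: s2 :> seq V
      & r = tensor t - (-1) ^ (p * q) *: tensor t'].

Definition symPow_space := quotSpace (lspan sym_rel).
HB.instance Definition _ := GRing.Lmodule.on symPow_space.

Definition sprod (t : k.-tuple V) : symPow_space := qclass (tensor t).

Lemma sprod_multilinear : multilinear sprod.
Proof.
move=> s1 s2 a x y t tx ty tE txE tyE; rewrite /sprod -linearP.
by rewrite (tensor_multilinear tE txE tyE).
Qed.

Definition gr_symmetric (W : lmodType rat) (f : k.-tuple V -> W) : Prop :=
  forall (s1 s2 : seq V) (p q : int) (x y : V) (t t' : k.-tuple V),
    homog p x -> homog q y -> t = s1 ++ x :: y :: s2 :> seq V ->
    t' = s1 ++ y :: x :: s2 :> seq V -> f t = (-1) ^ (p * q) *: f t'.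

Lemma sprod_symmetric : gr_symmetric sprod.
Proof.
move=> s1 s2 p q x y t t' hx hy tE t'E; rewrite /sprod -linearZ.
by apply/qclassP/mem_lspan; exists s1, s2, p, q, x, y, t, t'.
Qed.

(* The linear map induced by a multilinear, graded symmetric [f]
   (see [sym_liftE] and [sym_lift_linear]). *)
Definition sym_lift (W : lmodType rat) (f : k.-tuple V -> W) :
  symPow_space -> W := qlift (tensor_lift f).

Section SymLift.
Variables (W : lmodType rat) (f : k.-tuple V -> W).
Hypotheses (fM : multilinear f) (fS : gr_symmetric f).

Let F := HB.pack_for {linear tensorPower k V -> W} (tensor_lift f)
  (GRing.isLinear.Build rat (tensorPower k V) W _ (tensor_lift f)
     (tensor_lift_linear fM)).

Fact tensor_lift_sym_rel r : r \in lspan sym_rel -> F r = 0.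
Proof.
apply: lspan_kernel => _ [s1 [s2 [p [q [x [y [t [t' [hx hy tE t'E ->]]]]]]]]].
rewrite linearB linearZ /= !tensor_liftE //.
by rewrite (fS hx hy tE t'E) subrr.
Qed.

Lemma sym_liftE t : sym_lift f (sprod t) = f t.
Proof. by rewrite /sym_lift (qliftE tensor_lift_sym_rel) /= tensor_liftE. Qed.

Lemma sym_lift_linear : linear (sym_lift f).
Proof. exact: (qlift_linear tensor_lift_sym_rel). Qed.
End SymLift.

Lemma sym_ext (W : lmodType rat) (f g : {linear symPow_space -> W}) :
  (forall t, f (sprod t) = g (sprod t)) -> f =1 g.
Proof.
move=> fg u; have [x ->] := qclass_surj u.
exact: (tensor_ext (f := f \o qclass) (g := g \o qclass)).
Qed.

(* Total degree: the span of the products x_1 ... x_k of homogeneous elements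
   whose degrees add up to [n]. *)
Definition homog_sprod (n : int) (u : symPow_space) : Prop :=
  exists (d : k.-tuple int) (t : k.-tuple V),
    [/\ forall i, homog (tnth d i) (tnth t i), \sum_(i < k) tnth d i = n
      & u = sprod t].

Definition sym_homog (n : int) (u : symPow_space) : Prop :=
  u \in lspan (homog_sprod n).

Fact sym_homog0 n : sym_homog n 0.
Proof. exact: rpred0. Qed.

Fact sym_homogP n a x y :
  sym_homog n x -> sym_homog n y -> sym_homog n (a *: x + y).
Proof. by move=> hx hy; rewrite /sym_homog rpredD ?rpredZ. Qed.

End SymmetricPower.

Section SymMap.
Variables (k : nat) (V W : gradedSpace).

(* The map x_1 ... x_k |-> f x_1 ... f x_k (see [symMapE]). *)
Definition symMap (f : V -> W) : symPow_space k V -> symPow_space k W :=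
  sym_lift (fun t => sprod (map_tuple f t)).

Variable f : {linear V -> W}.
Hypothesis f0 : has_degree 0 f.

Let F (t : k.-tuple V) := sprod (map_tuple f t).

Fact symMap_multilinear : multilinear F.
Proof.
move=> s1 s2 a x y t tx ty tE txE tyE.
apply: (@sprod_multilinear k W (map f s1) (map f s2) a (f x) (f y)).
- by rewrite /= tE map_cat /= linearP.
- by rewrite /= txE map_cat.
- by rewrite /= tyE map_cat.
Qed.

Fact symMap_symmetric : gr_symmetric F.
Proof.
move=> s1 s2 p q x y t t' hx hy tE t'E.
apply: (@sprod_symmetric k W (map f s1) (map f s2) p q (f x) (f y)).
- by rewrite -[p]addr0; apply: f0.
- by rewrite -[q]addr0; apply: f0.
- by rewrite /= tE map_cat.
- by rewrite /= t'E map_cat.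
Qed.

Lemma symMapE t : symMap f (sprod t) = sprod (map_tuple f t).
Proof. exact: (sym_liftE symMap_multilinear symMap_symmetric). Qed.

Lemma symMap_linear : linear (symMap f).
Proof. exact: (sym_lift_linear symMap_multilinear symMap_symmetric). Qed.

End SymMap.

Section SymGrading.
Variables (k : nat) (V : gradedSpace).

Lemma multilinear_scale (W : lmodType rat) (f : k.-tuple V -> W) :
  multilinear f -> forall (s : seq (rat * V)) (s1 : seq V) (t t' : k.-tuple V),
    t = s1 ++ [seq p.1 *: p.2 | p <- s] :> seq V ->
    t' = s1 ++ [seq p.2 | p <- s] :> seq V ->
    f t = (\prod_(p <- s) p.1) *: f t'.
Proof.
move=> fM; elim=> [|[c x] s IHs] s1 t t' /= tE t'E.
  by rewrite big_nil scale1r; congr f; apply: val_inj; rewrite /= tE t'E.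
have sz y : size (s1 ++ y :: [seq p.1 *: p.2 | p <- s]) == k.
  by rewrite -(size_tuple t) tE !size_cat.
pose T y : k.-tuple V := Tuple (sz y).
have fT y z a : f (T (a *: y + z)) = a *: f (T y) + f (T z).
  exact: (fM s1 [seq p.1 *: p.2 | p <- s]).
have fT0 : f (T 0) = 0.
  have /eqP := fT 0 0 1; rewrite scale1r addr0 scale1r -{1}[f (T 0)]addr0.
  by rewrite (inj_eq (addrI _)) => /eqP <-.
have -> : t = T (c *: x + 0) by apply: val_inj; rewrite /= addr0.
rewrite fT fT0 addr0 big_cons -scalerA; congr (_ *: _).
by apply: (IHs (rcons s1 x)); rewrite /= cat_rcons.
Qed.

Fact sym_homog_gen u : u \in lspan (fun v => exists n, @sym_homog k V n v).
Proof.
set S := lspan _.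
have hS (s2 s1 : seq V) (t : k.-tuple V) : t = s1 ++ s2 :> seq V ->
    (forall x, x \in s1 -> exists n, homog n x) -> sprod t \in S.
  elim: s2 s1 t => [|x s2 IHs] s1 t tE hs1.
    rewrite cats0 in tE.
    have /choice[d hd] : forall i : 'I_k, exists n, homog n (tnth t i).
      by move=> i; apply: hs1; rewrite -tE mem_tnth.
    apply: mem_lspan; exists (\sum_(i < k) tnth (mktuple d) i).
    apply: mem_lspan; exists (mktuple d), t; split=> // i.
    by rewrite tnth_mktuple.
  have sz y : size (s1 ++ y :: s2) == k.
    by rewrite -(size_tuple t) tE !size_cat.
  pose f y := sprod (Tuple (sz y)).
  have fL : linear f by move=> a y z; apply: (sprod_multilinear (s1 := s1)).
  pose F := HB.pack_for {linear V -> symPow_space k V} f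
    (GRing.isLinear.Build rat V (symPow_space k V) _ f fL).
  have -> : sprod t = F x by congr sprod; apply: val_inj.
  have [s [c [us hc ->]]] := homog_gen x.
  rewrite linear_sum; apply: rpred_sum => n _.
  apply: (IHs (rcons s1 (c n))); first by rewrite /= cat_rcons.
  move=> y; rewrite mem_rcons inE => /orP[/eqP->|/hs1//].
  by exists n.
suff : qclass u = 0 :> quotSpace S by move/eqP; rewrite quot_eq0.
have z_lin : linear (fun _ : symPow_space k V => 0 : quotSpace S).
  by move=> a x y; rewrite scaler0 addr0.
pose Z := HB.pack_for {linear symPow_space k V -> quotSpace S}
  (fun _ : symPow_space k V => 0 : quotSpace S)
  (GRing.isLinear.Build rat (symPow_space k V) (quotSpace S) _ _ z_lin).
apply: (sym_ext (f := qclass) (g := Z)) => t.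
by apply/eqP; rewrite quot_eq0; apply: (hS t [::]).
Qed.

Fact sym_homog_free (s : seq int) (c : int -> symPow_space k V) :
  uniq s -> (forall n, sym_homog n (c n)) -> \sum_(n <- s) c n = 0 ->
  forall n, n \in s -> c n = 0.
Proof.
pose w (n : int) := (2%:R : rat) ^ n.
have w0 : has_degree 0 (@grscale V w).
  by move=> n x hx; rewrite addr0 (grscaleE _ hx); apply: homogZ.
pose L := HB.pack_for {linear symPow_space k V -> symPow_space k V}
  (symMap (@grscale V w)) (GRing.isLinear.Build rat (symPow_space k V)
    (symPow_space k V) _ _ (symMap_linear w0)).
apply: (grading_free (@sym_homog0 k V) (@sym_homogP k V) (l := L)) => n u hu.
apply/eqP; rewrite -subr_eq0; apply/eqP.
have g_lin : linear (fun v => L v - w n *: v).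
  move=> a x y; rewrite linearP scalerDr scalerBr !scalerA mulrC.
  by rewrite addrACA -opprD.
pose G := HB.pack_for {linear symPow_space k V -> symPow_space k V}
  (fun v => L v - w n *: v)
  (GRing.isLinear.Build rat _ (symPow_space k V) _ _ g_lin).
apply: (lspan_kernel (f := G) _ hu) => _ [d [t [ht dn ->]]].
apply/eqP; rewrite /= subr_eq0 symMapE //; apply/eqP.
pose s2 := [seq (w (tnth d i), tnth t i) | i <- enum 'I_k].
rewrite (@multilinear_scale _ _ (@sprod_multilinear k V) s2 [::] _ t).
- rewrite big_map big_enum /= -dn /w; congr (_ *: _).
  elim/big_rec2: _ => // i y1 y2 _ ->; rewrite expfzDr //.
- rewrite /= -map_comp {1}(tuple_map_ord t) /= -map_comp.
  by apply: eq_map => i /=; apply: grscaleE.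
- by rewrite /= -map_comp {1}(tuple_map_ord t).
Qed.

(* \mathcal{G}^k V, graded by total degree *)
Definition symPow : gradedSpace := GradedSpace (@sym_homog0 k V)
  (@sym_homogP k V)
  (grading_gen (@sym_homog0 k V) (@sym_homogP k V) sym_homog_gen)
  sym_homog_free.

End SymGrading.

Lemma sym_has_degree (k : nat) (V W : gradedSpace) (m : int)
    (f : {linear symPow k V -> W}) :
  (forall (d : k.-tuple int) (t : k.-tuple V),
     (forall i, homog (tnth d i) (tnth t i)) ->
     homog (\sum_(i < k) tnth d i + m) (f (sprod t))) ->
  has_degree m f.
Proof.
move=> fm n u /asboolP hu.
pose P := [pred v : symPow k V | `[< homog (n + m) (f v) >]].
have Psub : submod_closed P.
  split=> [|a x y /asboolP hx /asboolP hy]; apply/asboolP.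
    by rewrite linear0; apply: homog0.
  by rewrite linearP; apply: homogP.
pose PS : submodClosed (symPow k V) :=
  HB.pack (P : {pred symPow k V}) (GRing.isSubmodClosed.Build rat _ P Psub).
apply/asboolP; apply: (hu PS) => _ [d [t [ht dn ->]]].
by apply/asboolP; rewrite -dn; apply: fm.
Qed.

Lemma tuple2E (T : Type) (t : 2.-tuple T) :
  t = [tuple tnth t ord0; tnth t ord_max] :> seq T.
Proof. by case: t => -[|a [|b [|c s]]]. Qed.

Section SymSquare.
Variable V : gradedSpace.

Definition sprod2 (x y : V) : symPow 2 V := sprod [tuple x; y].

(* The linear map x y |-> f x y, for a bilinear and graded symmetric [f]
   (see [sym2_liftE] and [sym2_lift_linear]). *)
Definition sym2_lift (W : lmodType rat) (f : V -> V -> W) : symPow 2 V -> W :=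
  sym_lift (fun t : 2.-tuple V => f (tnth t ord0) (tnth t ord_max)).

Lemma sprod2E (t : 2.-tuple V) : sprod t = sprod2 (tnth t ord0) (tnth t ord_max).
Proof. by congr sprod; apply: val_inj; rewrite /= {1}tuple2E. Qed.

Lemma sprod2_linearl y : linear (sprod2^~ y).
Proof. by move=> a x x'; apply: (sprod_multilinear (s1 := [::]) (s2 := [:: y])). Qed.

Lemma sprod2_linearr x : linear (sprod2 x).
Proof. by move=> a y y'; apply: (sprod_multilinear (s1 := [:: x]) (s2 := [::])). Qed.

Lemma sprod2C p q x y : homog p x -> homog q y ->
  sprod2 x y = (-1) ^ (p * q) *: sprod2 y x.
Proof.
by move=> hx hy; apply: (sprod_symmetric (s1 := [::]) (s2 := [::]) hx hy).
Qed.

Lemma homog_sprod2 p q x y : homog p x -> homog q y ->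
  homog (p + q) (sprod2 x y).
Proof.
move=> hx hy; apply: mem_lspan; exists [tuple p; q], [tuple x; y].
by split=> //; [case=> -[|[|//]] | rewrite !big_ord_recl big_ord0 addr0].
Qed.

Lemma sym2_ext (W : lmodType rat) (f g : {linear symPow 2 V -> W}) :
  (forall x y, f (sprod2 x y) = g (sprod2 x y)) -> f =1 g.
Proof. by move=> fg; apply: sym_ext => t; rewrite sprod2E. Qed.

Lemma sym2_hext (W : lmodType rat) (f g : {linear symPow 2 V -> W}) :
  (forall p q x y, homog p x -> homog q y ->
     f (sprod2 x y) = g (sprod2 x y)) -> f =1 g.
Proof.
move=> fg; apply: sym2_ext => x y.
pose lx (F : {linear symPow 2 V -> W}) y0 := HB.pack_for {linear V -> W}
  (F \o sprod2^~ y0) (GRing.isLinear.Build rat V W _ (F \o sprod2^~ y0)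
    (fun a u v => etrans (congr1 F (sprod2_linearl y0 a u v)) (linearP F a _ _))).
pose ly (F : {linear symPow 2 V -> W}) x0 := HB.pack_for {linear V -> W}
  (F \o sprod2 x0) (GRing.isLinear.Build rat V W _ (F \o sprod2 x0)
    (fun a u v => etrans (congr1 F (sprod2_linearr x0 a u v)) (linearP F a _ _))).
apply: (homog_spanP (f := lx f y) (g := lx g y)) => p x0 hx.
by apply: (homog_spanP (f := ly f x0) (g := ly g x0)) => q y0 hy; apply: fg hx hy.
Qed.

Lemma sym2_homog_ind n (P : symPow 2 V -> Prop) :
  P 0 -> (forall a u v, P u -> P v -> P (a *: u + v)) ->
  (forall p q x y, homog p x -> homog q y -> p + q = n -> P (sprod2 x y)) ->
  forall u, homog n u -> P u.
Proof.
move=> P0 PP Pm u /asboolP hu.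
have Psub : submod_closed [pred v : symPow 2 V | `[< P v >]].
  split=> [|a x y /asboolP hx /asboolP hy]; apply/asboolP => //.
  exact: PP.
pose PS : submodClosed (symPow 2 V) := HB.pack
  ([pred v | `[< P v >]] : {pred symPow 2 V})
  (GRing.isSubmodClosed.Build rat _ [pred v : symPow 2 V | `[< P v >]] Psub).
apply/asboolP; apply: (hu PS) => _ [d [t [ht dn ->]]].
apply/asboolP; rewrite sprod2E; apply: Pm (ht _) (ht _) _.
rewrite -dn big_ord_recl big_ord1; congr (_ + tnth d _).
exact: val_inj.
Qed.

Section Lift.
Variables (W : lmodType rat) (f : V -> V -> W).
Hypotheses (fl : forall y, linear (f^~ y)) (fr : forall x, linear (f x)).
Hypothesis fC : forall p q x y, homog p x -> homog q y ->
  f x y = (-1) ^ (p * q) *: f y x.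

Let F (t : 2.-tuple V) := f (tnth t ord0) (tnth t ord_max).

Lemma bilinear_multilinear : multilinear F.
Proof.
move=> s1 s2 a x y t tx ty; rewrite (tuple2E t) (tuple2E tx) (tuple2E ty).
case: s1 => [|z [|z' s1]] /=.
- by rewrite /F => -[-> e1] [-> e2] [-> e3]; have [-> ->] : 
    tnth t ord_max = tnth ty ord_max /\ tnth tx ord_max = tnth ty ord_max;
    [move: e1 e2; rewrite -e3 => -[->] [->] | rewrite fl].
- by rewrite /F => -[-> -> _] [-> -> _] [-> -> _]; rewrite fr.
- by case=> _ _; case: s1.
Qed.

Lemma bilinear_symmetric : gr_symmetric F.
Proof.
move=> s1 s2 p q x y t t' hx hy; rewrite (tuple2E t) (tuple2E t').
case: s1 => [|z [|z' s1]] /=; rewrite /F.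
- by case=> -> -> _ [-> -> _]; apply: fC.
- by case=> _ _.
- by case=> _ _; case: s1.
Qed.

Lemma sym2_liftE x y : sym2_lift f (sprod2 x y) = f x y.
Proof. exact: (sym_liftE bilinear_multilinear bilinear_symmetric). Qed.

Lemma sym2_lift_linear : linear (sym2_lift f).
Proof. exact: (sym_lift_linear bilinear_multilinear bilinear_symmetric). Qed.

Lemma sym2_lift_degree (U : gradedSpace) (m : int) (g : {linear symPow 2 V -> U}) :
  (forall p q x y, homog p x -> homog q y -> homog (p + q + m) (g (sprod2 x y))) ->
  has_degree m g.
Proof.
move=> gm; apply: sym_has_degree => d t ht; rewrite sprod2E.
by rewrite big_ord_recl big_ord1; have -> : fintype.lift ord0 ord0 = ord_max :> 'I_2;
  [apply: val_inj | apply: gm].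
Qed.
End Lift.

End SymSquare.

Section LinearCombination.
Variables (V W : lmodType rat).

Lemma linear_scale (a : rat) (f : V -> W) : linear f -> linear (fun v => a *: f v).
Proof. by move=> fL b u v; rewrite fL scalerDr !scalerA mulrC. Qed.

Lemma linear_comb (a : rat) (f g : V -> W) :
  linear f -> linear g -> linear (fun v => a *: f v + g v).
Proof.
by move=> fL gL b u v; rewrite fL gL !scalerDr !scalerA mulrC addrACA.
Qed.

Definition to_linear (f : V -> W) (fL : linear f) : {linear V -> W} :=
  HB.pack_for {linear V -> W} f (GRing.isLinear.Build rat V W _ f fL).
End LinearCombination.

Section FullSymmetrisation.
Variable V : gradedSpace.

Definition sprod4 (x y z w : V) : symPow 4 V := sprod [tuple x; y; z; w].

Definition sym_cat (u v : symPow 2 V) : symPow 4 V :=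
  sym2_lift (fun x y => sym2_lift (fun z w => sprod4 x y z w) v) u.

(* (x y)(z w) |-> x y z w, by [full_symE] and [sym_catE] *)
Definition full_sym : symPow 2 (symPow 2 V) -> symPow 4 V := sym2_lift sym_cat.

Fact sprod4_linear1 y z w : linear (fun x => sprod4 x y z w).
Proof. by move=> a x x'; apply: (sprod_multilinear (s1 := [::]) (s2 := [:: y; z; w])). Qed.
Fact sprod4_linear2 x z w : linear (fun y => sprod4 x y z w).
Proof. by move=> a y y'; apply: (sprod_multilinear (s1 := [:: x]) (s2 := [:: z; w])). Qed.
Fact sprod4_linear3 x y w : linear (fun z => sprod4 x y z w).
Proof. by move=> a z z'; apply: (sprod_multilinear (s1 := [:: x; y]) (s2 := [:: w])). Qed.
Fact sprod4_linear4 x y z : linear (fun w => sprod4 x y z w).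
Proof. by move=> a w w'; apply: (sprod_multilinear (s1 := [:: x; y; z]) (s2 := [::])). Qed.
Fact sprod4C12 p q x y z w : homog p x -> homog q y ->
  sprod4 x y z w = (-1) ^ (p * q) *: sprod4 y x z w.
Proof. by move=> hx hy; apply: (sprod_symmetric (s1 := [::]) (s2 := [:: z; w]) hx hy). Qed.
Fact sprod4C23 p q x y z w : homog p y -> homog q z ->
  sprod4 x y z w = (-1) ^ (p * q) *: sprod4 x z y w.
Proof. by move=> hx hy; apply: (sprod_symmetric (s1 := [:: x]) (s2 := [:: w]) hx hy). Qed.
Fact sprod4C34 p q x y z w : homog p z -> homog q w ->
  sprod4 x y z w = (-1) ^ (p * q) *: sprod4 x y w z.
Proof. by move=> hx hy; apply: (sprod_symmetric (s1 := [:: x; y]) (s2 := [::]) hx hy). Qed.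

Let inner x y (v : symPow 2 V) := sym2_lift (fun z w => sprod4 x y z w) v.

Fact innerE x y z w : inner x y (sprod2 z w) = sprod4 x y z w.
Proof.
apply: (sym2_liftE (f := sprod4 x y)) => [w'|z'|]; first exact: sprod4_linear3.
  exact: sprod4_linear4.
by move=> p q z' w'; apply: sprod4C34.
Qed.

Fact inner_linear x y : linear (inner x y).
Proof.
apply: (sym2_lift_linear (f := sprod4 x y)) => [w'|z'|]; first exact: sprod4_linear3.
  exact: sprod4_linear4.
by move=> p q z' w'; apply: sprod4C34.
Qed.

HB.instance Definition _ x y :=
  GRing.isLinear.Build rat _ _ _ (inner x y) (inner_linear x y).

Fact inner_linearl y v : linear (fun x => inner x y v).
Proof.
move=> a x x'; have gL : linear (fun v => a *: inner x y v + inner x' y v).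
  by apply: linear_comb; apply: inner_linear.
pose G := to_linear gL.
apply: (sym2_ext (f := inner (a *: x + x') y) (g := G)) => z w /=.
by rewrite !innerE sprod4_linear1.
Qed.

Fact inner_linearr x v : linear (fun y => inner x y v).
Proof.
move=> a y y'; have gL : linear (fun v => a *: inner x y v + inner x y' v).
  by apply: linear_comb; apply: inner_linear.
pose G := to_linear gL.
apply: (sym2_ext (f := inner x (a *: y + y')) (g := G)) => z w /=.
by rewrite !innerE sprod4_linear2.
Qed.

Fact innerC v p q x y : homog p x -> homog q y ->
  inner x y v = (-1) ^ (p * q) *: inner y x v.
Proof.
move=> hx hy; have gL : linear (fun v => ((-1) ^ (p * q) : rat) *: inner y x v).
  by apply: linear_scale; apply: inner_linear.
pose G := to_linear gL.
apply: (sym2_ext (f := inner x y) (g := G)) => z w /=.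
by rewrite !innerE (sprod4C12 _ _ hx hy).
Qed.

Lemma sym_catE x y z w : sym_cat (sprod2 x y) (sprod2 z w) = sprod4 x y z w.
Proof.
rewrite -innerE; apply: (sym2_liftE (f := fun x y => inner x y (sprod2 z w))).
- by move=> y'; apply: inner_linearl.
- by move=> x'; apply: inner_linearr.
- exact: innerC.
Qed.

Lemma sym_cat_linearl v : linear (sym_cat^~ v).
Proof.
apply: (sym2_lift_linear (f := fun x y => inner x y v)).
- by move=> y'; apply: inner_linearl.
- by move=> x'; apply: inner_linearr.
- exact: innerC.
Qed.

Let catl v := to_linear (sym_cat_linearl v).

Lemma sym_cat_linearr u : linear (sym_cat u).
Proof.
move=> a v v'; have gL : linear (fun u => a *: sym_cat u v + sym_cat u v').
  by apply: linear_comb; apply: sym_cat_linearl.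
pose G := to_linear gL.
apply: (sym2_ext (f := catl (a *: v + v')) (g := G)) => x y /=.
have cE v0 : sym_cat (sprod2 x y) v0 = inner x y v0.
  apply: (sym2_liftE (f := fun x y => inner x y v0)).
  - by move=> y'; apply: inner_linearl.
  - by move=> x'; apply: inner_linearr.
  - exact: innerC.
by rewrite !cE linearP.
Qed.

Fact sym_cat0l v : sym_cat 0 v = 0.
Proof. exact: (linear0 (to_linear (sym_cat_linearl v))). Qed.

Fact sym_cat0r u : sym_cat u 0 = 0.
Proof. exact: (linear0 (to_linear (sym_cat_linearr u))). Qed.

Lemma sym_catC p q u v : homog p u -> homog q v ->
  sym_cat u v = (-1) ^ (p * q) *: sym_cat v u.
Proof.
move=> hu hv; elim/sym2_homog_ind: u / hu => [|a u u' IHu IHu'|a b x y ha hb <-].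
- by rewrite sym_cat0l sym_cat0r scaler0.
- rewrite sym_cat_linearl sym_cat_linearr IHu IHu' scalerDr.
  by rewrite !scalerA [a * _]mulrC.
elim/sym2_homog_ind: v / hv => [|c v v' IHv IHv'|c d z w hc hd <-].
- by rewrite sym_cat0l sym_cat0r scaler0.
- rewrite sym_cat_linearl sym_cat_linearr IHv IHv' scalerDr.
  by rewrite !scalerA [c * _]mulrC.
rewrite !sym_catE (sprod4C23 _ _ hb hc) (sprod4C12 _ _ ha hc).
rewrite (sprod4C34 _ _ hb hd) (sprod4C23 _ _ ha hd) !scalerA -!expfzDr //.
by congr (_ ^ _ *: _); ring.
Qed.

Lemma homog_sprod4 a b c d x y z w :
  homog a x -> homog b y -> homog c z -> homog d w ->
  homog (a + b + (c + d)) (sprod4 x y z w).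
Proof.
move=> ha hb hc hd; apply: mem_lspan.
exists [tuple a; b; c; d], [tuple x; y; z; w]; split=> //.
  by case=> -[|[|[|[|//]]]].
by rewrite !big_ord_recl big_ord0 addr0 !addrA.
Qed.

Lemma homog_sym_cat p q u v : homog p u -> homog q v -> homog (p + q) (sym_cat u v).
Proof.
move=> hu hv; elim/sym2_homog_ind: u / hu => [|a u u' IHu IHu'|a b x y ha hb <-].
- by rewrite sym_cat0l; apply: homog0.
- by rewrite sym_cat_linearl; apply: homogP.
elim/sym2_homog_ind: v / hv => [|c v v' IHv IHv'|c d z w hc hd <-].
- by rewrite sym_cat0r; apply: homog0.
- by rewrite sym_cat_linearr; apply: homogP.
by rewrite sym_catE; apply: homog_sprod4.
Qed.

Lemma full_symE u v : full_sym (sprod2 u v) = sym_cat u v.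
Proof.
exact: (sym2_liftE sym_cat_linearl sym_cat_linearr sym_catC).
Qed.

Fact full_sym_linear : linear full_sym.
Proof. exact: (sym2_lift_linear sym_cat_linearl sym_cat_linearr sym_catC). Qed.

HB.instance Definition _ :=
  GRing.isLinear.Build rat _ _ _ full_sym full_sym_linear.

Fact full_sym_degree : has_degree 0 full_sym.
Proof.
apply: (sym2_lift_degree (g := full_sym)) => p q u v hu hv.
by rewrite addr0 /= full_symE; apply: homog_sym_cat.
Qed.

End FullSymmetrisation.

(* -------------------------------------------------------------------- *)
(* Graded commutative (unital) DGAs over the rationals, Z-graded, with a
   differential of degree 1. The product is a field rather than an [algType]
   structure because the latter excludes the zero algebra. *)
Record cdga := Cdga {
  dga_space :> gradedSpace;
  dga_mul : dga_space -> dga_space -> dga_space;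
  dga_one : dga_space;
  dga_mulA : associative dga_mul;
  dga_mul1l : left_id dga_one dga_mul;
  dga_mul1r : right_id dga_one dga_mul;
  dga_mul_linearl : forall y, linear (dga_mul^~ y);
  dga_mul_linearr : forall x, linear (dga_mul x);
  dga_homog1 : homog 0 dga_one;
  dga_homogM : forall p q x y,
    homog p x -> homog q y -> homog (p + q) (dga_mul x y);
  dga_mulC : forall p q x y, homog p x -> homog q y ->
    dga_mul x y = (-1) ^ (p * q) *: dga_mul y x;
  dga_d : {linear dga_space -> dga_space};
  dga_d_degree : has_degree 1 dga_d;
  dga_dd : forall x, dga_d (dga_d x) = 0;
  dga_leibniz : forall p x y, homog p x ->
    dga_d (dga_mul x y) = dga_mul (dga_d x) y + (-1) ^ p *: dga_mul x (dga_d y)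
}.

Section Cohomology.
Variable A : cdga.
Local Notation d := (@dga_d A).
Local Notation "x ⋅ y" := (dga_mul x y) (at level 40, left associativity).

Definition cocycles : gradedSpace := grkernel (@dga_d_degree A).
Local Notation Z := cocycles.

Lemma cocycleP (z : Z) : d (val z) = 0.
Proof. by apply/eqP; have := valP z. Qed.

Definition boundary : {pred Z} := [pred z | `[< exists a, val z = d a >]].

Lemma boundaryP (z : Z) : reflect (exists a, val z = d a) (z \in boundary).
Proof. exact: asboolP. Qed.

Fact boundary_submod : submod_closed boundary.
Proof.
split=> [|c x y /boundaryP[a xa] /boundaryP[b yb]]; apply/boundaryP.
  by exists 0; rewrite linear0.
by exists (c *: a + b); rewrite linearP -xa -yb.
Qed.

HB.instance Definition _ :=
  GRing.isSubmodClosed.Build rat Z boundary boundary_submod.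

(* Cohomology, with the degree of a class being that of a homogeneous
   representative. *)
Definition coh_space := quotSpace boundary.
HB.instance Definition _ := GRing.Lmodule.on coh_space.

Definition coh_class (z : Z) : coh_space := qclass z.
HB.instance Definition _ := GRing.isLinear.Build rat Z coh_space _ coh_class
  (@qclass_linear Z boundary).

Definition coh_homog (n : int) (h : coh_space) : Prop :=
  exists2 z : Z, homog n z & h = coh_class z.

Fact coh_homog0 n : coh_homog n 0.
Proof. by exists 0; rewrite ?linear0 //; apply: homog0. Qed.

Fact coh_homogP n a x y :
  coh_homog n x -> coh_homog n y -> coh_homog n (a *: x + y).
Proof.
move=> [z hz ->] [z' hz' ->]; exists (a *: z + z'); rewrite ?linearP //.
exact: homogP.
Qed.

Fact coh_homog_gen h : exists (s : seq int) (c : int -> coh_space),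
  [/\ uniq s, forall n, coh_homog n (c n) & h = \sum_(n <- s) c n].
Proof.
have [z ->] := qclass_surj h; have [s [c [us hc ->]]] := homog_gen z.
by exists s, (coh_class \o c); split=> [//|n|]; [exists (c n)|rewrite linear_sum].
Qed.

Fact coh_homog_free (s : seq int) (c : int -> coh_space) :
  uniq s -> (forall n, coh_homog n (c n)) -> \sum_(n <- s) c n = 0 ->
  forall n, n \in s -> c n = 0.
Proof.
pose w (n : int) := (2%:R : rat) ^ n.
have valL (z : Z) : val (@grscale Z w z) = @grscale A w (val z).
  pose vL : {linear Z -> A} := val.
  apply: (@homog_spanP Z A (vL \o @grscale Z w) (@grscale A w \o vL)) => n x hx.
  rewrite [LHS]/= (grscaleE _ hx) [RHS]/= (@grscaleE A w n (val x)) //.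
have dL (a : A) : @grscale A w (d a) = d (2%:R *: @grscale A w a).
  pose m : {linear A -> A} := to_linear (linear_scale 2%:R (@grscale_linear A w)).
  apply: (@homog_spanP A A (@grscale A w \o d) (d \o m)) => n x hx.
  rewrite [LHS]/= (grscaleE _ (dga_d_degree hx)) [RHS]/= /= (grscaleE _ hx).
  by rewrite scalerA linearZ /w expfzDr // expr1z mulrC.
pose L := (coh_class \o @grscale Z w).
have LB z : z \in boundary -> L z = 0.
  move=> /boundaryP[a za]; apply/eqP; rewrite quot_eq0; apply/boundaryP.
  by exists (2%:R *: @grscale A w a); rewrite -dL -za; apply: valL.
pose LH := to_linear (qlift_linear LB).
apply: (grading_free coh_homog0 coh_homogP (l := LH)) => n _ [z hz ->].
by rewrite /= (qliftE LB) /= (grscaleE _ hz) linearZ.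
Qed.

Definition cohomology : gradedSpace :=
  GradedSpace coh_homog0 coh_homogP coh_homog_gen coh_homog_free.
Local Notation H := cohomology.

Fact dga_mul0l y : 0 ⋅ y = 0 :> A.
Proof. exact: (linear0 (to_linear (dga_mul_linearl y))). Qed.
Fact dga_mul0r x : x ⋅ 0 = 0 :> A.
Proof. exact: (linear0 (to_linear (dga_mul_linearr x))). Qed.
Fact dga_mul_suml (I : Type) (r : seq I) (F : I -> A) y :
  (\sum_(i <- r) F i) ⋅ y = \sum_(i <- r) F i ⋅ y.
Proof. exact: (linear_sum (to_linear (dga_mul_linearl y))). Qed.

Fact cocycle_mul (x y : Z) : val x ⋅ val y \in kernel d.
Proof.
have [s [c [us hc ->]]] := homog_gen x.
rewrite raddf_sum dga_mul_suml; apply: rpred_sum => n _.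
rewrite inE (dga_leibniz _ (hc n)) !cocycleP dga_mul0l dga_mul0r.
by rewrite scaler0 addr0.
Qed.

Definition cmul (x y : Z) : Z := exist _ (val x ⋅ val y) (cocycle_mul x y).

Lemma cmul_linearl y : linear (cmul^~ y).
Proof. by move=> a x x'; apply: val_inj; apply: dga_mul_linearl. Qed.
Lemma cmul_linearr x : linear (cmul x).
Proof. by move=> a y y'; apply: val_inj; apply: dga_mul_linearr. Qed.
Lemma homog_cmul p q x y : homog p x -> homog q y -> homog (p + q) (cmul x y).
Proof. exact: dga_homogM. Qed.
Lemma cmulC p q x y : homog p x -> homog q y ->
  cmul x y = (-1) ^ (p * q) *: cmul y x.
Proof. by move=> hx hy; apply: val_inj; apply: dga_mulC. Qed.

Fact boundary_mull x y : x \in boundary -> cmul x y \in boundary.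
Proof.
move=> /boundaryP[a xa]; have [s [c [us hc aE]]] := homog_gen a.
apply/boundaryP; exists (a ⋅ val y).
rewrite /= [sval x]xa aE !linear_sum !dga_mul_suml linear_sum.
apply: eq_bigr => n _; rewrite (dga_leibniz _ (hc n)) cocycleP dga_mul0r.
by rewrite scaler0 addr0.
Qed.

Fact boundary_mulr x y : y \in boundary -> cmul x y \in boundary.
Proof.
move=> /boundaryP[b yb]; have [s [c [us hc ->]]] := homog_gen x.
have -> : cmul (\sum_(n <- s) c n) y = \sum_(n <- s) cmul (c n) y.
  exact: (linear_sum (to_linear (cmul_linearl y))).
apply: rpred_sum => n _; apply/boundaryP; exists ((-1) ^ n *: (val (c n) ⋅ b)).
rewrite linearZ /= (dga_leibniz _ (hc n)) cocycleP dga_mul0l add0r -yb.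
by rewrite scalerA -expfzMl mulrNN mulr1 exp1rz scale1r.
Qed.

(* The product of H^*, through representatives (see [hmulE]). *)
Definition hmul (h h' : H) : H :=
  qlift (fun x => qlift (fun y => coh_class (cmul x y)) h') h.

Lemma hmulE x y : hmul (coh_class x) (coh_class y) = coh_class (cmul x y).
Proof.
rewrite /hmul /qlift; set x' := repr _; set y' := repr _.
have hx : x' - x \in boundary by apply/qclassP; rewrite qclass_reprK.
have hy : y' - y \in boundary by apply/qclassP; rewrite qclass_reprK.
apply/qclassP; rewrite -[cmul x' y'](subrK (cmul x y')) -addrA rpredD //.
  rewrite -(linearB (to_linear (cmul_linearl y'))); exact: boundary_mull.
rewrite -(linearB (to_linear (cmul_linearr x))); exact: boundary_mulr.
Qed.

Lemma hmul_linearl h' : linear (hmul^~ h').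
Proof.
move=> a h1 h2; have [y ->] := qclass_surj h'.
have [[x1 ->] [x2 ->]] := (qclass_surj h1, qclass_surj h2).
by rewrite -linearP !hmulE cmul_linearl linearP.
Qed.

Lemma hmul_linearr h : linear (hmul h).
Proof.
move=> a h1 h2; have [x ->] := qclass_surj h.
have [[y1 ->] [y2 ->]] := (qclass_surj h1, qclass_surj h2).
by rewrite -linearP !hmulE cmul_linearr linearP.
Qed.

Lemma homog_hmul p q h h' : homog p h -> homog q h' -> homog (p + q) (hmul h h').
Proof.
move=> [x hx ->] [y hy ->]; rewrite hmulE; exists (cmul x y) => //.
exact: homog_cmul.
Qed.

Lemma hmulC p q h h' : homog p h -> homog q h' ->
  hmul h h' = (-1) ^ (p * q) *: hmul h' h.
Proof.
by move=> [x hx ->] [y hy ->]; rewrite !hmulE (cmulC hx hy) linearZ.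
Qed.

(* x y |-> x * y on \mathcal{G}^2 H^* (see [hprodE]) *)
Definition hprod : symPow 2 H -> H := sym2_lift hmul.

Lemma hprodE x y : hprod (sprod2 x y) = hmul x y.
Proof. exact: (sym2_liftE hmul_linearl hmul_linearr hmulC). Qed.

Fact hprod_linear : linear hprod.
Proof. exact: (sym2_lift_linear hmul_linearl hmul_linearr hmulC). Qed.

HB.instance Definition _ := GRing.isLinear.Build rat _ _ _ hprod hprod_linear.

Fact hprod_degree : has_degree 0 hprod.
Proof.
apply: (sym2_lift_degree (g := hprod)) => p q x y hx hy.
by rewrite addr0 /= hprodE; apply: homog_hmul.
Qed.

(* E^*, the kernel of [hprod] *)
Definition Espace : gradedSpace := grkernel hprod_degree.
Local Notation E := Espace.

Definition E_incl (e : E) : symPow 2 H := val e.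
HB.instance Definition _ := GRing.isLinear.Build rat E (symPow 2 H) _ E_incl
  (fun _ _ _ => erefl).

Fact E_incl_degree : has_degree 0 E_incl.
Proof. by move=> n e he; rewrite addr0. Qed.

Definition G2E_incl : symPow 2 E -> symPow 2 (symPow 2 H) := symMap E_incl.

Lemma G2E_inclE e e' :
  G2E_incl (sprod2 e e') = sprod2 (E_incl e) (E_incl e').
Proof.
by rewrite /G2E_incl (symMapE E_incl_degree) sprod2E.
Qed.

Fact G2E_incl_linear : linear G2E_incl.
Proof. exact: (symMap_linear E_incl_degree). Qed.

HB.instance Definition _ :=
  GRing.isLinear.Build rat _ _ _ G2E_incl G2E_incl_linear.

Fact BM_degree : has_degree 0 (@full_sym H \o G2E_incl).
Proof.
move=> n u hu; apply: full_sym_degree => //=.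
rewrite -[n]addr0; move: n u hu.
apply: (sym2_lift_degree (g := G2E_incl)) => p q e e' he he'.
rewrite addr0 /= G2E_inclE.
by apply: homog_sprod2; rewrite -[X in homog X]addr0; apply: E_incl_degree.
Qed.

(* \mathcal{B}^* = \mathcal{G}^2 E^* \cap K, as the subspace of those b in
   \mathcal{G}^2 E^* whose image in \mathcal{G}^2 \mathcal{G}^2 H^* lies in
   K = kernel full_sym (see [mem_BM]); over a field [G2E_incl] is injective. *)
Definition BM : gradedSpace := grkernel BM_degree.

Lemma mem_BM (b : symPow 2 E) :
  (b \in kernel (@full_sym H \o G2E_incl)) = (G2E_incl b \in kernel (@full_sym H)).
Proof. by rewrite !inE. Qed.

(* \alpha^2 : \mathcal{G}^2 H^* -> Z^* (see [sqE]) *)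
Definition sq (alpha : H -> Z) : symPow 2 H -> Z :=
  sym2_lift (fun x y => cmul (alpha x) (alpha y)).

Section Square.
Variable alpha : {linear H -> Z}.
Hypothesis alpha0 : has_degree 0 alpha.

Let f x y := cmul (alpha x) (alpha y).
Fact sq_fl y : linear (f^~ y).
Proof. by move=> a x x'; rewrite /f linearP cmul_linearl. Qed.
Fact sq_fr x : linear (f x).
Proof. by move=> a y y'; rewrite /f linearP cmul_linearr. Qed.
Fact sq_fC p q x y : homog p x -> homog q y -> f x y = (-1) ^ (p * q) *: f y x.
Proof. by move=> /alpha0 hx /alpha0 hy; rewrite !addr0 in hx hy; apply: cmulC. Qed.

Lemma sqE x y : sq alpha (sprod2 x y) = cmul (alpha x) (alpha y).
Proof. exact: (sym2_liftE sq_fl sq_fr sq_fC). Qed.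

Lemma sq_linear : linear (sq alpha).
Proof. exact: (sym2_lift_linear sq_fl sq_fr sq_fC). Qed.
End Square.

Definition is_section (alpha : {linear H -> Z}) : Prop :=
  has_degree 0 alpha /\ forall h, coh_class (alpha h) = h.

Definition is_primitive (alpha : {linear H -> Z}) (gamma : {linear E -> A}) : Prop :=
  has_degree (-1) gamma /\ forall e, d (gamma e) = val (sq alpha (E_incl e)).

Definition is_gamma_sq (alpha : {linear H -> Z}) (gamma : {linear E -> A})
    (Phi : {linear symPow 2 E -> A}) : Prop :=
  forall (p q : int) (e e' : E), homog p e -> homog q e' ->
    Phi (sprod2 e e') =
      (2%:R : rat)^-1 *: (gamma e ⋅ val (sq alpha (E_incl e'))
        + (-1) ^ (p * q) *: (gamma e' ⋅ val (sq alpha (E_incl e)))).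

(* Phi takes values in cocycles on \mathcal{B}^*, and F is the induced map. *)
Definition induces (Phi : symPow 2 E -> A) (F : BM -> H) : Prop :=
  forall b : BM, exists2 z : Z, val z = Phi (val b) & F b = coh_class z.

End Cohomology.

(* Main.v *)
(* Modulo exact elements, integration by parts gives
   gamma.alpha^2 (e e') = gamma(e) alpha^2(e'), and its differential is
   alpha^2(e) alpha^2(e'), which only depends on the image of e e' in
   \mathcal{G}^4 H and hence vanishes on \mathcal{B}.

   For independence, write alpha' - alpha = d beta with beta : H -> A linear
   (linear algebra over a field, by Zorn's lemma). The telescoping sums
   T(x_1 ... x_k) =
     sum_i +- alpha(x_1)...alpha(x_(i-1)) beta(x_i) alpha'(x_(i+1))...alpha'(x_k)
   are primitives of alpha'(x_1)...alpha'(x_k) - alpha(x_1)...alpha(x_k), and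
   modulo exact elements they are graded symmetric. On \mathcal{G}^2 E, the
   difference of the two maps gamma.alpha^2 is, modulo exact elements, T on
   \mathcal{G}^4 H composed with the full symmetrisation, so that it vanishes
   on \mathcal{B}. *)
Require Import Defs.
From HB Require Import structures.
From mathcomp Require Import all_boot all_order all_algebra.
From mathcomp Require Import boolp classical_sets ring.

Set Implicit Arguments.
Unset Strict Implicit.
Unset Printing Implicit Defensive.

Import GRing.Theory.
Local Open Scope ring_scope.

(** * Complements of kernels and linear lifts *)

Section LinearSelection.
Variables (U V W : lmodType rat) (f : {linear V -> W}).

Lemma maximal_complement : exists C : set V,
  [/\ C 0, forall a x y, C x -> C y -> C (a *: x + y),
      forall x, C x -> f x = 0 -> x = 0
    & forall v, exists2 c, C c & f c = f v].
Proof.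
(* Zorn's lemma includes the empty chain, whose union is empty, so [P] has to hold of the empty set;
   [C 0] is recovered afterwards from maximality, by comparison with the zero subspace. *)
pose P (C : set V) := (forall a x y, C x -> C y -> C (a *: x + y)) /\
  (forall x, C x -> f x = 0 -> x = 0).
have [F FP Ftot|C [[CP Cker] Cmax]] := @Zorn_bigcup V P.
  split=> [a x y [X FX Xx] [Y FY Yy]|x [X /FP[_ XP]]]; last exact: XP.
  have [XY|YX] := Ftot X Y FX FY.
    by exists Y => //; have [YP _] := FP Y FY; apply: YP => //; apply: XY.
  by exists X => //; have [XP _] := FP X FX; apply: XP => //; apply: YX.
have C0 : C 0.
  apply: contrapT => nC0; apply: (Cmax [set 0]%classic).
    split=> [x Cx|/(_ 0 erefl)//]; case: nC0.
    by rewrite -(addNr x) -scaleN1r; apply: CP.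
  by split=> [a x y -> ->|x ->//]; rewrite scaler0 addr0.
exists C; split=> // v; apply: contrapT => nv.
(* If [f v] were missed on [C], adjoining the line through [v] would still avoid the kernel, against
   maximality. *)
pose C' : set V := [set x | exists a c, C c /\ x = a *: v + c]%classic.
have CZ a c : C c -> C (a *: c) by move=> Cc; rewrite -[_ *: _]addr0; apply: CP.
apply: (Cmax C').
  split=> [c Cc|/(_ v) sC]; first by exists 0, c; rewrite scale0r add0r.
  by apply: nv; exists v => //; apply: sC; exists 1, 0; rewrite scale1r addr0.
split=> [a _ _ [b [c [Cc ->]]] [b' [c' [Cc' ->]]]|_ [a [c [Cc ->]]]].
  exists (a * b + b'), (a *: c + c'); split; first exact: CP.
  by rewrite scalerDr scalerDl scalerA addrACA.
have [->|a0] := eqVneq a 0; first by rewrite scale0r add0r; apply: Cker.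
rewrite linearP => /eqP; rewrite addr_eq0 => /eqP fv; case: nv.
exists (- a^-1 *: c); first exact: CZ.
by rewrite linearZ /= scaleNr -scalerN -fv scalerA mulVf ?scale1r.
Qed.

(** [f] is injective on the complement [C], so preimages chosen inside [C] are unique and hence
    depend linearly on [u]. *)
Lemma linear_selection (g : {linear U -> W}) :
  (forall u, exists v, f v = g u) ->
  exists h : {linear U -> V}, forall u, f (h u) = g u.
Proof.
move=> gf; have [C [C0 CP Cker Cf]] := maximal_complement.
have /choice[h hP] : forall u, exists c, C c /\ f c = g u.
  by move=> u; have [v <-] := gf u; have [c Cc fc] := Cf v; exists c.
have h_lin : linear h.
  move=> a x y; apply/eqP; rewrite -subr_eq0; apply/eqP/Cker.
    rewrite [X in C X]addrC -scaleN1r; apply: (CP); last by case: (hP (a *: x + y)).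
    by apply: CP; [case: (hP x)|case: (hP y)].
  rewrite linearB linearP.
  have [[_ ->] [[_ ->] [_ ->]]] := (hP (a *: x + y), (hP x, hP y)).
  by rewrite linearP subrr.
by exists (to_linear h_lin) => u; case: (hP u).
Qed.

End LinearSelection.

(** * The parity involution and the sign rules of a DGA *)

Local Notation sgn := (grscale (fun n : int => (-1 : rat) ^ n)).

Lemma signK (n : int) : ((-1 : rat) ^ n) * (-1) ^ n = 1.
Proof. by rewrite -expfzMl mulrNN mulr1 exp1rz. Qed.

Section SignInvolution.
Variable V : gradedSpace.

Lemma sgnK (x : V) : sgn (sgn x) = x.
Proof.
apply: (homog_spanP (f := @grscale V _ \o @grscale V _) (g := idfun)) => n y hy /=.
by rewrite (grscaleE _ hy) linearZ /= (grscaleE _ hy) scalerA signK scale1r.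
Qed.

Lemma sgn_degree0 (W : gradedSpace) (f : {linear V -> W}) :
  has_degree 0 f -> forall x, sgn (f x) = f (sgn x).
Proof.
move=> f0; apply: (homog_spanP (f := @grscale W _ \o f) (g := f \o @grscale V _)).
move=> n x hx /=; have hf := f0 _ _ hx; rewrite addr0 in hf.
by rewrite !(grscaleE _ hx) (grscaleE _ hf) linearZ.
Qed.

End SignInvolution.

Section CdgaSigns.
Variable A : cdga.
Local Notation d := (@dga_d A).
Local Notation "x ⋅ y" := (dga_mul x y) (at level 40, left associativity).

Definition mull (y : A) : {linear A -> A} := to_linear (dga_mul_linearl y).
Definition mulr (x : A) : {linear A -> A} := to_linear (dga_mul_linearr x).

Lemma dga_mulDl (x y z : A) : (x + y) ⋅ z = x ⋅ z + y ⋅ z.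
Proof. exact: (raddfD (mull z)). Qed.
Lemma dga_mulDr (x y z : A) : z ⋅ (x + y) = z ⋅ x + z ⋅ y.
Proof. exact: (raddfD (mulr z)). Qed.
Lemma dga_mulBl (x y z : A) : (x - y) ⋅ z = x ⋅ z - y ⋅ z.
Proof. exact: (raddfB (mull z)). Qed.
Lemma dga_mulBr (x y z : A) : z ⋅ (x - y) = z ⋅ x - z ⋅ y.
Proof. exact: (raddfB (mulr z)). Qed.
Lemma dga_mulNl (x z : A) : (- x) ⋅ z = - (x ⋅ z).
Proof. exact: (raddfN (mull z)). Qed.
Lemma dga_mulZl a (x z : A) : (a *: x) ⋅ z = a *: (x ⋅ z).
Proof. exact: (linearZ_LR (mull z)). Qed.
Lemma dga_mulZr a (x z : A) : z ⋅ (a *: x) = a *: (z ⋅ x).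
Proof. exact: (linearZ_LR (mulr z)). Qed.

Lemma sgn_d (x : A) : sgn (d x) = - d (sgn x).
Proof.
apply: (homog_spanP (f := @grscale A _ \o d) (g := -%R \o d \o @grscale A _)).
move=> n {}x hx /=; rewrite (grscaleE _ hx) (grscaleE _ (dga_d_degree hx)).
by rewrite expfzDr // expr1z mulrN1 linearZ scaleNr.
Qed.

Lemma sgn_cocycle (x : A) : d x = 0 -> d (sgn x) = 0.
Proof. by move=> dx; apply: oppr_inj; rewrite -sgn_d dx linear0 oppr0. Qed.

Lemma sgnM (x y : A) : sgn (x ⋅ y) = sgn x ⋅ sgn y.
Proof.
apply: (homog_spanP (f := @grscale A _ \o mull y)
  (g := mull (sgn y) \o @grscale A _)).
move=> p {}x hx /=.
apply: (homog_spanP (f := @grscale A _ \o mulr x)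
  (g := mulr (sgn x) \o @grscale A _)).
move=> q {}y hy /=; rewrite (grscaleE _ hx) (grscaleE _ hy).
by rewrite (grscaleE _ (dga_homogM hx hy)) dga_mulZl dga_mulZr scalerA expfzDr.
Qed.

Lemma sgn1 : sgn (dga_one A) = dga_one A.
Proof. by rewrite (grscaleE _ (dga_homog1 A)) expr0z scale1r. Qed.

(** With [sgn] carrying the sign, both sides are linear in [x], so the Leibniz rule extends from
    homogeneous elements to all of [A]. *)
Lemma d_dga_mul (x y : A) : d (x ⋅ y) = d x ⋅ y + sgn x ⋅ d y.
Proof.
apply: (homog_spanP (f := d \o mull y)
  (g := (mull y \o d) \+ (mull (d y) \o @grscale A _))).
by move=> p {}x hx /=; rewrite (dga_leibniz _ hx) (grscaleE _ hx) dga_mulZl.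
Qed.

Lemma d1 : d (dga_one A) = 0.
Proof.
have /eqP := d_dga_mul (dga_one A) (dga_one A).
rewrite sgn1 !dga_mul1l dga_mul1r -{1}[d _]addr0 (inj_eq (addrI _)).
by move/eqP.
Qed.

(* The sign rule only depends on the parity of the degree of [y], which [sgn]
   detects. *)
Lemma dga_mulC_sgn p q (x y : A) : homog p x -> sgn y = (-1) ^ q *: y ->
  x ⋅ y = (-1) ^ (p * q) *: (y ⋅ x).
Proof.
move=> hx sy; pose w (n : int) := (-1 : rat) ^ (p * n).
have -> : x ⋅ y = grscale w y ⋅ x.
  apply: (homog_spanP (f := mulr x) (g := mull x \o @grscale A w)) => n z hz /=.
  by rewrite (grscaleE _ hz) dga_mulZl; apply: dga_mulC.
suff -> : grscale w y = (-1) ^ (p * q) *: y by rewrite dga_mulZl.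
(* For even [p] all weights are 1 and [grscale w] is the identity; for odd [p] it is [sgn]. *)
have : ((-1 : rat) ^ p == 1) || ((-1 : rat) ^ p == -1).
  by rewrite -sqrf_eq1 expr2 signK.
have wE n : w n = ((-1) ^ p) ^ n by rewrite /w -exprz_exp.
rewrite (funext wE) -exprz_exp => /orP[] /eqP ->; last exact: sy.
rewrite exp1rz scale1r.
apply: (homog_spanP (f := @grscale A _) (g := idfun)) => n z hz /=.
by rewrite (grscaleE _ hz) exp1rz scale1r.
Qed.

(** A subspace of [A] rather than of the cocycles, so that elements that are not closed, such as
    telescoping sums, also have classes modulo it. *)
Definition exact_pred : {pred A} := [pred x | `[< exists a, x = d a >]].

Fact exact_submod : submod_closed exact_pred.
Proof.
split=> [|c x y /asboolP[a ->] /asboolP[b ->]]; apply/asboolP.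
  by exists 0; rewrite linear0.
by exists (c *: a + b); rewrite linearP.
Qed.

HB.instance Definition _ :=
  GRing.isSubmodClosed.Build rat A exact_pred exact_submod.

Lemma exact_d a : d a \in exact_pred.
Proof. by apply/asboolP; exists a. Qed.

Lemma exact_mul_cocycle x y : d y = 0 -> x \in exact_pred -> x ⋅ y \in exact_pred.
Proof.
move=> dy /asboolP[a ->]; apply/asboolP; exists (a ⋅ y).
by rewrite d_dga_mul dy dga_mul0r addr0.
Qed.

Lemma cocycle_mul_exact x y : d x = 0 -> y \in exact_pred -> x ⋅ y \in exact_pred.
Proof.
(* The twist by [sgn] cancels the sign in the Leibniz rule. *)
move=> dx /asboolP[a ->]; apply/asboolP; exists (sgn x ⋅ a).
by rewrite d_dga_mul sgnK sgn_cocycle // dga_mul0l add0r.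
Qed.

Lemma integration_by_parts x y : d x ⋅ y + sgn x ⋅ d y \in exact_pred.
Proof. by rewrite -d_dga_mul exact_d. Qed.

End CdgaSigns.

(** * Products of cocycles and telescoping primitives *)

Section CocycleProducts.
Variables (A : cdga) (V : gradedSpace).
Local Notation d := (@dga_d A).
Local Notation "x ⋅ y" := (dga_mul x y) (at level 40, left associativity).

Section Product.
Variable a : {linear V -> A}.

Definition mprod (s : seq V) : A := foldr (fun x => dga_mul (a x)) (dga_one A) s.

Lemma mprod_cat s1 s2 : mprod (s1 ++ s2) = mprod s1 ⋅ mprod s2.
Proof.
by elim: s1 => [|x s1 IHs] /=; rewrite ?dga_mul1l // IHs dga_mulA.
Qed.

Lemma mprod_linear s1 s2 c x y :
  mprod (s1 ++ (c *: x + y) :: s2) =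
  c *: mprod (s1 ++ x :: s2) + mprod (s1 ++ y :: s2).
Proof.
rewrite !mprod_cat /= linearP (dga_mul_linearl (mprod s2)).
exact: (dga_mul_linearr (mprod s1)).
Qed.

Lemma mprod_multilinear k : multilinear (fun t : k.-tuple V => mprod t).
Proof. by move=> s1 s2 c x y t tx ty -> -> ->; apply: mprod_linear. Qed.

Hypothesis a0 : has_degree 0 a.

Lemma mulC_degree0 p q x y : homog p x -> homog q y ->
  a x ⋅ a y = (-1) ^ (p * q) *: (a y ⋅ a x).
Proof. by move=> /a0 hx /a0 hy; rewrite !addr0 in hx hy; apply: dga_mulC. Qed.

Lemma mprod_symmetric k : gr_symmetric (fun t : k.-tuple V => mprod t).
Proof.
move=> s1 s2 p q x y t t' hx hy -> ->; rewrite !mprod_cat /=.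
by rewrite !(dga_mulA (a _) (a _)) (mulC_degree0 hx hy) dga_mulZl dga_mulZr.
Qed.

Hypothesis da : forall x, d (a x) = 0.

Lemma d_mprod s : d (mprod s) = 0.
Proof.
elim: s => [|x s IHs] /=; first exact: d1.
by rewrite d_dga_mul da IHs dga_mul0l dga_mul0r addr0.
Qed.

Definition sym_mprod k : {linear symPow k V -> A} :=
  to_linear (sym_lift_linear (@mprod_multilinear k) (@mprod_symmetric k)).

Lemma sym_mprodE k (t : k.-tuple V) : sym_mprod k (sprod t) = mprod t.
Proof. exact: (sym_liftE (@mprod_multilinear k) (@mprod_symmetric k)). Qed.

Opaque sym_mprod.

Lemma sym_mprod_degree k : has_degree 0 (sym_mprod k).
Proof.
apply: sym_has_degree => e t; rewrite sym_mprodE addr0.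
elim: k e t => [|k IHk] e t ht.
  by rewrite (tuple0 t) big_ord0; apply: dga_homog1.
rewrite big_ord_recl (tuple_eta t) /=; apply: dga_homogM.
  by rewrite -[X in homog X]addr0; apply: a0; apply: ht.
rewrite (eq_bigr (fun i => tnth [tuple of behead e] i)) => [|i _].
  apply: (IHk [tuple of behead e] [tuple of behead t]) => i.
  by rewrite !tnth_behead; apply: ht.
rewrite tnth_behead; congr tnth; apply: val_inj.
by rewrite /= inordK ?ltnS ?(valP i).
Qed.

(** This makes products of two values of [sym_mprod 2] factor through the full symmetrisation. *)
Lemma sym_mprod_cat u v :
  sym_mprod 4 (sym_cat u v) = sym_mprod 2 u ⋅ sym_mprod 2 v.
Proof.
apply: (sym2_ext (f := sym_mprod 4 \o to_linear (sym_cat_linearl v))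
                 (g := mull (sym_mprod 2 v) \o sym_mprod 2)) => x y.
apply: (sym2_ext (f := sym_mprod 4 \o to_linear (sym_cat_linearr (sprod2 x y)))
                 (g := mulr (sym_mprod 2 (sprod2 x y)) \o sym_mprod 2)) => z w.
rewrite [LHS]/= sym_catE [RHS]/= !sym_mprodE.
by rewrite -(mprod_cat [:: x; y] [:: z; w]).
Qed.

End Product.

(* Keeps [/=] from unfolding the induced maps below their bundled structure. *)
Opaque sym_mprod.

Variables a b beta : {linear V -> A}.
Hypotheses (a0 : has_degree 0 a) (b0 : has_degree 0 b).
Hypotheses (da : forall x, d (a x) = 0) (db : forall x, d (b x) = 0).
Hypothesis dbeta : forall x, d (beta x) = b x - a x.
Hypothesis sgn_beta :
  forall p x, homog p x -> sgn (beta x) = (-1) ^ (p - 1) *: beta x.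

(* The sum over i of +- a(x_1)...a(x_(i-1)) beta(x_i) b(x_(i+1))...b(x_k). *)
Fixpoint telescope (s : seq V) : A :=
  if s is x :: s' then beta x ⋅ mprod b s' + sgn (a x) ⋅ telescope s' else 0.

(** A derivation rule twisted by [a] on the left and [b] on the right; it reduces symmetry to two
    adjacent factors. *)
Lemma telescope_cat s1 s2 :
  telescope (s1 ++ s2) =
  telescope s1 ⋅ mprod b s2 + sgn (mprod a s1) ⋅ telescope s2.
Proof.
elim: s1 => [|x s1 IHs] /=; first by rewrite sgn1 dga_mul1l dga_mul0l add0r.
by rewrite IHs mprod_cat sgnM dga_mulDl dga_mulDr !dga_mulA addrA.
Qed.

Lemma d_telescope s : d (telescope s) = mprod b s - mprod a s.
Proof.
elim: s => [|x s IHs] /=; first by rewrite linear0 subrr.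
rewrite linearD /= !d_dga_mul dbeta (d_mprod db) (sgn_cocycle (da x)) IHs sgnK.
by rewrite dga_mul0l dga_mul0r addr0 add0r dga_mulBl dga_mulBr addrA subrK.
Qed.

Lemma telescope_linear s1 s2 c x y :
  telescope (s1 ++ (c *: x + y) :: s2) =
  c *: telescope (s1 ++ x :: s2) + telescope (s1 ++ y :: s2).
Proof.
pose L : {linear V -> A} := (mulr (telescope s1) \o mull (mprod b s2) \o b) \+
  (mulr (sgn (mprod a s1)) \o ((mull (mprod b s2) \o beta) \+
    (mull (telescope s2) \o @grscale A (fun n => (-1) ^ n) \o a))).
suff LE z : telescope (s1 ++ z :: s2) = L z by rewrite !LE linearP.
by rewrite telescope_cat.
Qed.

Local Notation cls := (@qclass A (@exact_pred A)).

(** The symmetry defect is [(-1) ^ (p - 1)] times the differential of [beta x ⋅ beta y]. *)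
Lemma telescope_swap p q x y : homog p x -> homog q y ->
  telescope [:: x; y] - (-1) ^ (p * q) *: telescope [:: y; x] \in @exact_pred A.
Proof.
move=> hx hy; rewrite /= !dga_mul1r !dga_mul0r !addr0.
have [ax bx] := (a0 hx, b0 hx); have [ay by_] := (a0 hy, b0 hy).
rewrite !addr0 in ax bx ay by_.
rewrite (grscaleE _ ax) (grscaleE _ ay).
have yx : (-1 : rat) ^ (p * q) *: (beta y ⋅ b x) = (-1) ^ p *: (b x ⋅ beta y).
  rewrite (dga_mulC_sgn bx (sgn_beta hy)) scalerA -expfzDr //.
  by congr (_ ^ _ *: _); ring.
have xy : (-1 : rat) ^ (p * q) *: ((-1) ^ q *: (a y ⋅ beta x)) = beta x ⋅ a y.
  rewrite (dga_mulC_sgn ay (sgn_beta hx)) !scalerA -!expfzDr //.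
  have -> : p * q + q + q * (p - 1) = p * q + p * q by ring.
  by rewrite expfzDr // signK scale1r.
rewrite !dga_mulZl scalerDr yx xy.
rewrite (_ : _ + _ - _ = (-1) ^ (p - 1) *:
  (d (beta x) ⋅ beta y + sgn (beta x) ⋅ d (beta y))).
  by rewrite rpredZ // integration_by_parts.
rewrite (sgn_beta hx) !dbeta dga_mulZl scalerDr scalerA signK scale1r.
rewrite expfzDr // exprN1 invrN1 mulrN1 scaleNr dga_mulBl dga_mulBr scalerBr.
by rewrite [X in _ - X = _]addrC opprD addrACA opprB [RHS]addrC.
Qed.

Lemma telescope_multilinear k :
  multilinear (fun t : k.-tuple V => cls (telescope t)).
Proof.
by move=> s1 s2 c x y t tx ty -> -> ->; rewrite telescope_linear linearP.
Qed.

(** Expanding by [telescope_cat], the terms where [x] and [y] both enter through [a], or both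
    through [b], cancel exactly. What remains is the defect of [telescope_swap] between two
    cocycles, which is exact. *)
Lemma telescope_symmetric k :
  gr_symmetric (fun t : k.-tuple V => cls (telescope t)).
Proof.
move=> s1 s2 p q x y t t' hx hy -> ->; rewrite -linearZ.
have mE (f : {linear V -> A}) : has_degree 0 f ->
    mprod f [:: x; y] = (-1) ^ (p * q) *: mprod f [:: y; x].
  by move=> f0; rewrite /= !dga_mul1r (mulC_degree0 f0 hx hy).
have catE z w : s1 ++ z :: w :: s2 = s1 ++ [:: z; w] ++ s2 by [].
apply/qclassP; rewrite !catE !telescope_cat !mprod_cat (mE _ b0) (mE _ a0).
rewrite !dga_mulZl !dga_mulZr linearZ_LR dga_mulZl !dga_mulDr !scalerDr.
rewrite dga_mulZr opprD addrACA subrr add0r opprD addrACA subrr addr0.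
rewrite -dga_mulZr -dga_mulBr -dga_mulZl -dga_mulBl.
apply: cocycle_mul_exact; first by rewrite sgn_cocycle // d_mprod.
by apply: exact_mul_cocycle; [rewrite d_mprod | apply: telescope_swap].
Qed.

Definition sym_telescope k : {linear symPow k V -> quotSpace (@exact_pred A)} :=
  to_linear (sym_lift_linear (@telescope_multilinear k) (@telescope_symmetric k)).

Lemma sym_telescopeE k (t : k.-tuple V) :
  sym_telescope k (sprod t) = cls (telescope t).
Proof. exact: (sym_liftE (@telescope_multilinear k) (@telescope_symmetric k)). Qed.

Opaque sym_telescope.

(** The symmetric telescoping map exists only modulo exact elements. Any linear lift [D] has a
    determined differential, since exact elements are closed. *)
Lemma sym_telescope_lift k : exists D : {linear symPow k V -> A},
  (forall u, cls (D u) = sym_telescope k u) /\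
  (forall u, d (D u) = sym_mprod b0 k u - sym_mprod a0 k u).
Proof.
have [u|D DE] := @linear_selection _ _ _ cls (sym_telescope k).
  by have [x ->] := qclass_surj (sym_telescope k u); exists x.
exists D; split=> // u.
apply: (sym_ext (f := d \o D) (g := sym_mprod b0 k \- sym_mprod a0 k)) => t.
rewrite [LHS]/= [RHS]/= !sym_mprodE -d_telescope; apply/eqP.
rewrite -subr_eq0 -linearB; have : cls (D (sprod t)) = cls (telescope t).
  by rewrite DE sym_telescopeE.
by move=> /qclassP/asboolP[z ->]; rewrite dga_dd.
Qed.

(** [D] differs from [telescope] by exact elements, which stay exact after multiplication by the
    cocycles in [telescope_cat]. *)
Lemma sym_telescope_cat (D : {linear symPow 2 V -> A}) :
  (forall u, cls (D u) = sym_telescope 2 u) -> forall u v,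
  sym_telescope 4 (sym_cat u v) =
  cls (D u ⋅ sym_mprod b0 2 v + sgn (sym_mprod a0 2 u) ⋅ D v).
Proof.
move=> DE u v.
apply: (sym2_ext (f := sym_telescope 4 \o to_linear (sym_cat_linearl v))
  (g := cls \o ((mull (sym_mprod b0 2 v) \o D) \+
    (mull (D v) \o @grscale A (fun n => (-1) ^ n) \o sym_mprod a0 2)))) => x y.
apply: (sym2_ext
  (f := sym_telescope 4 \o to_linear (sym_cat_linearr (sprod2 x y)))
  (g := cls \o ((mulr (D (sprod2 x y)) \o sym_mprod b0 2) \+
    (mulr (sgn (sym_mprod a0 2 (sprod2 x y))) \o D)))) => z w.
rewrite [LHS]/= sym_catE [RHS]/= !sym_mprodE sym_telescopeE.
rewrite (telescope_cat [:: x; y] [:: z; w]); apply/qclassP.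
have DT p q : telescope [:: p; q] - D (sprod2 p q) \in @exact_pred A.
  by apply/qclassP; rewrite DE sym_telescopeE.
rewrite opprD addrACA -dga_mulBl -dga_mulBr rpredD //.
  by apply: exact_mul_cocycle => //; apply: d_mprod.
by apply: cocycle_mul_exact => //; rewrite sgn_cocycle // d_mprod.
Qed.

(* Writing D for the lift of the telescoping map to \mathcal{G}^2 V, the
   element gamma'(e) - gamma(e) - D(e) is a cocycle, so its products with
   b^2(e') = d(gamma'(e')) are exact. *)
Lemma primitive_change (E : lmodType rat) (i : {linear E -> symPow 2 V})
    (g g' : {linear E -> A}) :
  (forall e, d (g e) = sym_mprod a0 2 (i e)) ->
  (forall e, d (g' e) = sym_mprod b0 2 (i e)) -> forall e e',
  cls (g' e ⋅ sym_mprod b0 2 (i e')) - cls (g e ⋅ sym_mprod a0 2 (i e')) =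
  sym_telescope 4 (sym_cat (i e) (i e')).
Proof.
move=> dg dg' e e'; have [D [DE dD]] := sym_telescope_lift 2.
rewrite (sym_telescope_cat DE) -linearB; apply/qclassP.
pose eta x := g' x - g x - D (i x).
have deta x : d (eta x) = 0 by rewrite !linearB /= dg dg' dD subrr.
pose y := g' e' - g e'.
(* The first bracket is the differential of [sgn (g e) ⋅ y]; each term of the second is a product of
   an exact element and a value of the cocycle [eta]. *)
have -> : g' e ⋅ sym_mprod b0 2 (i e') - g e ⋅ sym_mprod a0 2 (i e') -
    (D (i e) ⋅ sym_mprod b0 2 (i e') + sgn (sym_mprod a0 2 (i e)) ⋅ D (i e')) =
    (d (sgn (g e)) ⋅ y + sgn (sgn (g e)) ⋅ d y) +
    (eta e ⋅ d (g' e') - d (sgn (g e)) ⋅ eta e').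
  rewrite -!dg -!dg' sgn_d sgnK /eta /y linearB /= dga_mulNl !dga_mulBl.
  rewrite !dga_mulBr !dg !dg'; set P := g' e ⋅ _; set Q := g e ⋅ sym_mprod a0 _ _.
  set X := d _ ⋅ g' e' - _; set Y := g e ⋅ _; rewrite opprD !opprK.
  rewrite opprB (addrC X (Y - Q)) [RHS]addrACA [X + _]addrC subrK (addrACA Y).
  by rewrite [Y + _]addrC subrK !addrA.
apply: rpredD; first exact: integration_by_parts.
apply: rpredB.
  by apply: cocycle_mul_exact => //; apply: exact_d.
by apply: exact_mul_cocycle => //; apply: exact_d.
Qed.

End CocycleProducts.

Opaque sym_mprod sym_telescope.

(** * Homotopies between cohomologous maps of degree 0 *)

Section Homotopy.
Variables (A : cdga) (V : gradedSpace) (a b : {linear V -> A}).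
Local Notation d := (@dga_d A).
Hypotheses (a0 : has_degree 0 a) (b0 : has_degree 0 b).

(* The degree of beta is only controlled up to parity, which suffices for sign
   computations and is obtained by averaging beta against sgn. *)
Lemma exists_homotopy : (forall x, exists z, d z = b x - a x) ->
  exists beta : {linear V -> A}, (forall x, d (beta x) = b x - a x) /\
    (forall p x, homog p x -> sgn (beta x) = (-1) ^ (p - 1) *: beta x).
Proof.
case/(@linear_selection _ _ _ d (b \- a)) => h hE.
pose sV := @grscale V (fun n => (-1) ^ n); pose sA := @grscale A (fun n => (-1) ^ n).
(* As [sgn] anticommutes with [d] and commutes with [a] and [b], conjugating [h] by [sgn] and
   negating gives another homotopy; the average of the two reverses parity. *)
exists ((2%:R : rat)^-1 \*: (h \- (sA \o h \o sV))); split=> [x|p x hx].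
  rewrite linearZ linearB /= /sA /sV -[d (sgn _)]opprK -sgn_d !hE /= opprK.
  rewrite (linearB (@grscale A _)) /= (sgn_degree0 b0) (sgn_degree0 a0) !sgnK.
  by rewrite -mulr2n -scaler_nat scalerA mulVf ?scale1r.
rewrite /= /sV (grscaleE _ hx) 2!linearZ linearB /= scalerA mulrC -scalerA.
congr (_ *: _); rewrite /sA !linearZ /= sgnK expfzDr // exprN1 invrN1 mulrN1.
by rewrite scalerDr scalerA mulNr signK scaleN1r opprK addrC scalerN scaleNr.
Qed.

End Homotopy.

(** * The symmetrised product of a primitive with its differential *)

Section PrimitiveProduct.
Variables (A : cdga) (E : gradedSpace) (S g : {linear E -> A}).
Local Notation d := (@dga_d A).
Local Notation "x ⋅ y" := (dga_mul x y) (at level 40, left associativity).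
Hypotheses (S0 : has_degree 0 S) (g1 : has_degree (-1) g).
Hypothesis dg : forall e, d (g e) = S e.

(* The sign of the symmetrised product is absorbed in sgn by swapping the
   factors of its second term. *)
Definition half_mul (e e' : E) : A :=
  (2%:R : rat)^-1 *: (g e ⋅ S e' + sgn (S e) ⋅ g e').

Lemma half_mulE p q e e' : homog p e -> homog q e' ->
  (2%:R : rat)^-1 *: (g e ⋅ S e' + (-1) ^ (p * q) *: (g e' ⋅ S e)) =
  half_mul e e'.
Proof.
move=> he he'; congr (_ *: (_ + _)).
have := S0 he; rewrite addr0 => hS.
rewrite (dga_mulC (g1 he') hS) scalerA -expfzDr // (grscaleE _ hS) dga_mulZl.
congr (_ *: _).
(* [g e'] has degree [q - 1]; modulo even exponents the total sign is [(-1) ^ p], which is the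
   action of [sgn] on [S e]. *)
have -> : p * q + (q - 1) * p = (p * q + p * q) + p - (p + p) by ring.
by rewrite !expfzDr // -invr_expz expfzDr // !signK invr1 mulr1 mul1r.
Qed.

Lemma half_mul_linearl e' : linear (half_mul^~ e').
Proof.
exact: (linearP ((2%:R : rat)^-1 \*: ((mull (S e') \o g) \+
  (mull (g e') \o @grscale A (fun n => (-1) ^ n) \o S)))).
Qed.

Lemma half_mul_linearr e : linear (half_mul e).
Proof.
exact: (linearP ((2%:R : rat)^-1 \*: ((mulr (g e) \o S) \+
  (mulr (sgn (S e)) \o g)))).
Qed.

Lemma half_mulC p q e e' : homog p e -> homog q e' ->
  half_mul e e' = (-1) ^ (p * q) *: half_mul e' e.
Proof.
move=> he he'; rewrite -(half_mulE he he') -(half_mulE he' he).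
rewrite [RHS]scalerA [_ * _^-1]mulrC -[RHS]scalerA; congr (_ *: _).
by rewrite scalerDr scalerA [q * p]mulrC signK scale1r addrC.
Qed.

Definition sym_half_mul : {linear symPow 2 E -> A} :=
  to_linear (sym2_lift_linear half_mul_linearl half_mul_linearr half_mulC).

Lemma sym_half_mulE e e' : sym_half_mul (sprod2 e e') = half_mul e e'.
Proof. exact: (sym2_liftE half_mul_linearl half_mul_linearr half_mulC). Qed.

Opaque sym_half_mul.

Lemma sym_half_mul_degree : has_degree (-1) sym_half_mul.
Proof.
apply: (sym2_lift_degree (g := sym_half_mul)) => p q e e' he he'.
rewrite sym_half_mulE -(half_mulE he he').
have hS := S0 he; have hS' := S0 he'; rewrite !addr0 in hS hS'.
apply: homogZ; apply: homogD; last apply: homogZ.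
  by rewrite addrAC; apply: dga_homogM hS'; apply: g1.
by rewrite [p + q]addrC addrAC; apply: dga_homogM hS; apply: g1.
Qed.

Lemma d_half_mul e e' : d (half_mul e e') = S e ⋅ S e'.
Proof.
have dS x : d (S x) = 0 by rewrite -dg dga_dd.
rewrite linearZ linearD /= !d_dga_mul !dS !dg sgn_cocycle // sgnK.
rewrite dga_mul0l dga_mul0r addr0 add0r -mulr2n -scaler_nat scalerA.
by rewrite mulVf ?scale1r.
Qed.

(** The two summands of [half_mul] differ by the differential of [sgn (g e) ⋅ g e'], up to sign, so
    modulo exact elements their average is either one. *)
Lemma half_mul_exact e e' : half_mul e e' - g e ⋅ S e' \in @exact_pred A.
Proof.
have -> : half_mul e e' - g e ⋅ S e' = (2%:R : rat)^-1 *: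
    (- (d (sgn (g e)) ⋅ g e' + sgn (sgn (g e)) ⋅ d (g e'))).
  have half (x : A) : x = (2%:R : rat)^-1 *: (x + x).
    by rewrite -mulr2n -scaler_nat scalerA mulVf ?scale1r.
  rewrite sgnK -[d (sgn _)]opprK -sgn_d !dg {1}[g e ⋅ _ in X in _ - X]half.
  rewrite -scalerBr opprD addrACA subrr add0r; congr (_ *: _).
  by rewrite dga_mulNl opprD opprK.
by rewrite rpredZ // rpredN integration_by_parts.
Qed.

End PrimitiveProduct.

Opaque sym_half_mul.

Lemma grkernelE (V W : gradedSpace) k (f : {linear V -> W})
  (fk : has_degree k f) (b : grkernel fk) : f (val b) = 0.
Proof. by apply/eqP; have := valP b. Qed.

(** * The induced map and its independence of the choices *)

Section InducedMap.
Variable A : cdga.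
Local Notation d := (@dga_d A).
Local Notation H := (cohomology A).
Local Notation Z := (cocycles A).
Local Notation E := (Espace A).
Local Notation "x ⋅ y" := (dga_mul x y) (at level 40, left associativity).
Local Notation cls := (@qclass A (@exact_pred A)).

Lemma full_sym_BM (b : BM A) : full_sym (G2E_incl (val b)) = 0.
Proof. exact: (grkernelE (fk := @BM_degree A) b). Qed.

Definition cocycle_val : {linear Z -> A} := val.

Section Choice.
Variables (alpha : {linear H -> Z}) (gamma : {linear E -> A}).
Hypotheses (alphaP : is_section alpha) (gammaP : is_primitive alpha gamma).

Definition cochain_of : {linear H -> A} := cocycle_val \o alpha.

Lemma cochain_of_degree : has_degree 0 cochain_of.
Proof. by move=> n x; apply: alphaP.1. Qed.

Lemma d_cochain_of x : d (cochain_of x) = 0.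
Proof. exact: cocycleP. Qed.

Local Notation alpha_sq := (sym_mprod cochain_of_degree 2).

Lemma val_sq u : val (sq alpha u) = alpha_sq u.
Proof.
apply: (sym2_ext (f := cocycle_val \o to_linear (sq_linear alphaP.1))
  (g := alpha_sq)) => x y.
by rewrite [LHS]/= (sqE alphaP.1) sym_mprodE /= dga_mul1r.
Qed.

Definition E_sq : {linear E -> A} := alpha_sq \o @E_incl A.

Lemma E_sq_degree : has_degree 0 E_sq.
Proof.
by move=> n e he; apply: (sym_mprod_degree cochain_of_degree); apply: he.
Qed.

Lemma d_gamma e : d (gamma e) = E_sq e.
Proof. by rewrite gammaP.2 val_sq. Qed.

Definition gamma_sq : {linear symPow 2 E -> A} :=
  sym_half_mul E_sq_degree gammaP.1.

(** The formula is prescribed only on products of homogeneous elements, but these span the symmetric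
    square and so determine [Phi]. *)
Lemma is_gamma_sqP (Phi : {linear symPow 2 E -> A}) :
  is_gamma_sq alpha gamma Phi <-> Phi =1 gamma_sq.
Proof.
split=> [PhiE|PhiE p q e e' he he'].
  apply: sym2_hext => p q e e' he he'.
  by rewrite (PhiE _ _ _ _ he he') !val_sq sym_half_mulE
    -(half_mulE E_sq_degree gammaP.1 he he').
by rewrite PhiE !val_sq sym_half_mulE -(half_mulE E_sq_degree gammaP.1 he he').
Qed.

Lemma d_gamma_sq (b : BM A) : d (gamma_sq (val b)) = 0.
Proof.
have dE u : d (gamma_sq u) = sym_mprod cochain_of_degree 4 (full_sym (G2E_incl u)).
  apply: (sym2_ext (f := d \o gamma_sq)
    (g := sym_mprod cochain_of_degree 4 \o @full_sym H \o @G2E_incl A)) => e e'.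
  rewrite [LHS]/= [RHS]/= sym_half_mulE (d_half_mul d_gamma).
  by rewrite G2E_inclE full_symE sym_mprod_cat.
by rewrite dE full_sym_BM linear0.
Qed.

Definition induced_cocycle (b : BM A) : Z :=
  Sub (gamma_sq (val b)) (introT eqP (d_gamma_sq b)).

Fact induced_cocycle_linear : linear induced_cocycle.
Proof.
move=> c x y; apply: val_inj; pose BM_val : {linear BM A -> symPow 2 E} := val.
exact: (linearP (gamma_sq \o BM_val) c x y).
Qed.

Definition induced_class : {linear BM A -> H} :=
  @coh_class A \o to_linear induced_cocycle_linear.

Lemma induced_class_degree : has_degree (-1) induced_class.
Proof.
move=> n b hb; exists (induced_cocycle b) => //.
exact: (sym_half_mul_degree E_sq_degree gammaP.1).
Qed.

Lemma induces_induced_class : induces gamma_sq induced_class.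
Proof. by move=> b; exists (induced_cocycle b). Qed.

End Choice.

Lemma gamma_sq_independent (alpha alpha' : {linear H -> Z})
    (gamma gamma' : {linear E -> A})
    (alphaP : is_section alpha) (gammaP : is_primitive alpha gamma)
    (alphaP' : is_section alpha') (gammaP' : is_primitive alpha' gamma') b :
  full_sym (G2E_incl b) = 0 ->
  gamma_sq alphaP' gammaP' b - gamma_sq alphaP gammaP b \in @exact_pred A.
Proof.
move=> bK; pose a := cochain_of alpha; pose a' := cochain_of alpha'.
pose a0 := cochain_of_degree alphaP; pose a0' := cochain_of_degree alphaP'.
(* Two sections differ pointwise by exact elements, since both represent the same class. *)
have [x|beta [dbeta sbeta]] := exists_homotopy a0 a0'.
  have /qclassP/boundaryP[z zE] : coh_class (alpha' x) = coh_class (alpha x).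
    by rewrite alphaP.2 alphaP'.2.
  by exists z; rewrite -zE.
have da := @d_cochain_of alpha; have da' := @d_cochain_of alpha'.
pose Psi := sym_telescope a0 a0' da da' dbeta sbeta.
have PsiE u : cls (gamma_sq alphaP' gammaP' u - gamma_sq alphaP gammaP u) =
    Psi 4 (full_sym (G2E_incl u)).
  apply: (sym2_ext
    (f := cls \o (gamma_sq alphaP' gammaP' \- gamma_sq alphaP gammaP))
    (g := Psi 4 \o @full_sym H \o @G2E_incl A)) => e e'.
  rewrite [LHS]/= [RHS]/= G2E_inclE full_symE /Psi.
  rewrite -(primitive_change da da' dbeta sbeta (i := @E_incl A)
    (d_gamma alphaP gammaP) (d_gamma alphaP' gammaP')).
  (* Modulo exact elements each symmetrised product becomes the one-sided product treated by
     [primitive_change]. *)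
  rewrite !sym_half_mulE linearB; congr (_ - _); apply/qclassP.
    exact: half_mul_exact (d_gamma alphaP' gammaP') _ _.
  exact: half_mul_exact (d_gamma alphaP gammaP) _ _.
by rewrite -quot_eq0 PsiE bK linear0.
Qed.

End InducedMap.

Theorem lemma2p5 (A : cdga) :
  (forall (alpha : {linear cohomology A -> cocycles A})
          (gamma : {linear Espace A -> A}),
     is_section alpha -> is_primitive alpha gamma ->
     exists Phi : {linear symPow 2 (Espace A) -> A},
       [/\ is_gamma_sq alpha gamma Phi,
           forall Psi : {linear symPow 2 (Espace A) -> A},
             is_gamma_sq alpha gamma Psi -> Psi =1 Phi,
           has_degree (-1) Phi,
           forall b : BM A, dga_d A (Phi (val b)) = 0
         & exists F : {linear BM A -> cohomology A},
             has_degree (-1) F /\ induces Phi F])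
  /\
  (forall (alpha alpha' : {linear cohomology A -> cocycles A})
          (gamma gamma' : {linear Espace A -> A})
          (Phi Phi' : {linear symPow 2 (Espace A) -> A})
          (F F' : BM A -> cohomology A),
     is_section alpha -> is_primitive alpha gamma ->
     is_section alpha' -> is_primitive alpha' gamma' ->
     is_gamma_sq alpha gamma Phi -> is_gamma_sq alpha' gamma' Phi' ->
     induces Phi F -> induces Phi' F' ->
     F =1 F').
Proof.
split=> [alpha gamma alphaP gammaP|].
  exists (gamma_sq alphaP gammaP); split.
  - exact/is_gamma_sqP.
  - by move=> Psi /is_gamma_sqP; apply.
  - exact: sym_half_mul_degree.
  - exact: d_gamma_sq.
  exists (induced_class alphaP gammaP); split; first exact: induced_class_degree.
  exact: induces_induced_class.
move=> alpha alpha' gamma gamma' Phi Phi' F F' alphaP gammaP alphaP' gammaP'.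
move=> /(is_gamma_sqP alphaP gammaP) PhiE /(is_gamma_sqP alphaP' gammaP') PhiE'.
move=> FP FP' b; have [z zE ->] := FP b; have [z' zE' ->] := FP' b.
apply/esym/qclassP/boundaryP.
have := gamma_sq_independent alphaP gammaP alphaP' gammaP' (full_sym_BM b).
by rewrite -PhiE -PhiE' -zE -zE' => /asboolP[c cE]; exists c; rewrite -cE.
Qed.
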